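(* Let $P$ be the transition kernel of a $\pi$-irreducible Markov chain that is reversible with respect to its invariant probability measure $\pi$. Assume that there exist a set $A\in\mathscr{B}(X)$ with $\pi(A)>0$ and a constant $\kappa>1$ such that, for some constant $\delta>0$ and some probability measure $\nu$ on $\mathscr{B}(X)$, $$P(x,B)\ge\delta1_A(x)\nu(B),\qquad x\in X,\ B\in\mathscr{B}(X),$$ $L:=\sup_{x\in A}\mathbb{E}_x[\kappa^{\tau_A}]<\infty$, and $$\sup_{x\in A}\sum_{n=1}^{\infty}\kappa^{2n}F^{2n}(x,A)\le\theta$$ for some $\theta<1$. Then for $\pi$-a.s. $x\in X$ there exists a constant $C(x)<\infty$ such that (for all $n$) $$\|P^n(x,\cdot)-\pi\|_{\mathrm{Var}}\le C(x)\Gamma^{-n},$$ where $\Gamma=\kappa\wedge(1-\delta^2\nu(A))^{-1/\gamma}$ and $$\gamma=\Bigl(\log\frac{L^2/(1-\theta)-\delta^2\nu(A)\kappa^2}{1-\delta^2\nu(A)}\Bigr)\Big/(\log\kappa).$$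
   Context: $\Phi=\{\Phi_n:n\in\mathbb{Z}_+\}$ is a discrete-time homogeneous Markov chain on a general state space $X$ with countably generated $\sigma$-field $\mathscr{B}(X)$ and $n$-step transition kernel $P^n(x,B)=\mathbb{P}_x\{\Phi_n\in B\}$; $\mathbb{P}_x,\mathbb{E}_x$ are probability and expectation given $\Phi_0=x$. The chain has a (unique) invariant probability measure $\pi$ and is $\pi$-irreducible: if $\pi(B)>0$, there exists $n\in\mathbb{N}$ such that $P^n(x,B)>0$ for all $x\in X$. It is assumed that $P^n(x,\cdot)\ll\pi$ ($n\ge1$), with density $p^n(x,y)$. Reversible: $\pi(dx)P(x,dy)=\pi(dy)P(y,dx)$. $\tau_A=\inf\{n\ge1:\Phi_n\in A\}$, $F^n(x,A)=\mathbb{P}_x\{\tau_A=n\}$. $\|\mu\|_{\mathrm{Var}}=\sup_{|f|\le1}|\mu(f)|$ for a signed measure $\mu$. $a\wedge b=\min\{a,b\}$. *)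

(* Defs.v *)
From HB Require Import structures.
From mathcomp Require Import all_boot all_order all_algebra.
From mathcomp Require Import all_classical all_reals all_analysis.

Set Implicit Arguments.
Unset Strict Implicit.
Unset Printing Implicit Defensive.

Import Order.TTheory GRing.Theory Num.Theory.
Import numFieldNormedType.Exports.

Local Open Scope classical_set_scope.
Local Open Scope ring_scope.
Local Open Scope ereal_scope.

Definition countably_generated d (X : measurableType d) : Prop :=
  exists2 G : set (set X), countable G & <<s G >> = @measurable d X.

Definition tv_dist d (X : measurableType d) (R : realType)
    (mu nu : probability X R) : \bar R :=
  ereal_sup [set `| \int[mu]_y (f y)%:E - \int[nu]_y (f y)%:E |
            | f in [set f : X -> R | measurable_fun [set: X] f /\
                                     (forall y, `|f y| <= 1)%R]].

Section kernel.
Context d (X : measurableType d) (R : realType).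
Variables (P : R.-pker X ~> X) (pi : probability X R).

Definition invariant_probability : Prop :=
  forall B, measurable B -> \int[pi]_x P x B = pi B.

(* Equality of the measures pi(dx) P(x, dy) and pi(dy) P(y, dx) on X * X. *)
Definition reversible : Prop :=
  forall E : set (X * X), measurable E ->
    \int[pi]_x P x (xsection E x) = \int[pi]_y P y (ysection E y).

End kernel.

Section chain.
Context d (X : measurableType d) (R : realType).
Context dO (Omega : measurableType dO).
Variables (Phi : nat -> {mfun Omega >-> X}) (Pr : X -> probability Omega R).

(* The sigma-field of events determined by Phi_0, ..., Phi_n. *)
Definition history (n : nat) : set (set Omega) :=
  <<s \bigcup_(k in [set k | (k <= n)%N])
        preimage_set_system [set: Omega] (Phi k) (@measurable d X) >>.

(* Phi is, under each Pr x, a homogeneous Markov chain with transition kernel P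
   started at x. The initial condition is stated through the law of Phi_0
   because points of X need not be measurable. *)
Definition markov_chain (P : R.-pker X ~> X) : Prop :=
  (forall x B, measurable B -> distribution (Pr x) (Phi 0%N) B = \d_x B) /\
  (forall x n E B, history n E -> measurable B ->
     Pr x (E `&` Phi n.+1 @^-1` B) = \int[Pr x]_(w in E) P (Phi n w) B).

Definition nstep (n : nat) (x : X) : probability X R :=
  distribution (Pr x) (Phi n).

Definition irreducible (pi : probability X R) : Prop :=
  forall B, measurable B -> 0 < pi B ->
    forall x, exists2 n, (0 < n)%N & 0 < nstep n x B.

Definition return_time (A : set X) (w : Omega) : \bar R :=
  ereal_inf [set n%:R%:E | n in [set n | (1 <= n)%N /\ A (Phi n w)]].

Definition first_return (n : nat) (x : X) (A : set X) : \bar R :=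
  Pr x [set w | return_time A w = n%:R%:E].

(* kappa ^ t for kappa > 1 and t in [-oo, +oo]. *)
Definition pow_ext (kappa : R) (t : \bar R) : \bar R :=
  match t with
  | r%:E => (kappa `^ r)%:E
  | +oo => +oo
  | -oo => 0
  end.

Definition return_moment (kappa : R) (A : set X) (x : X) : \bar R :=
  \int[Pr x]_w pow_ext kappa (return_time A w).

End chain.

Section rate.
Context (R : realType).
Local Open Scope ring_scope.

(* Here b stands for delta ^ 2 * nu(A), which lies in [0, 1]. *)
Definition rate_gamma (kappa L theta b : R) : R :=
  ln ((L ^+ 2 / (1 - theta) - b * kappa ^+ 2) / (1 - b)) / ln kappa.

(* When b = 1 the formula involves a division by 0; its limit as b tends to 1
   from below is kappa, and this value is used. *)
Definition rate_Gamma (kappa L theta b : R) : R :=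
  if b == 1 then kappa
  else Num.min kappa ((1 - b) `^ (- (rate_gamma kappa L theta b)^-1)).

End rate.

(* Main.v *)
(* For [x] in [A] the kernel [P x] contains the multiple [delta * nu] of [nu], and
   the two-step kernel [Q = P^2] contains [b * nu] with [b = delta^2 * nu A]; so
   both chains regenerate from [nu] at visits to [A].

   Splitting a return to [A] at even time according to the parity of the first
   return gives a function [V2 >= 1], equal to [1] on [A], with
   [kappa^2 Q V2 <= V2] off [A] and [<= L^2 / (1 - theta)] on [A]. By Jensen's
   inequality [v = V2^s], with [kappa^s = Gamma], satisfies
   [Gamma^2 (Q - b 1_A nu) v <= v], the definition of [gamma] being exactly what is
   needed on [A]. Hence the probability [rho_n] that no regeneration occurs before
   time [n] is at most [Gamma^(-2n) v].

   Let [h = dnu/dpi], which is bounded because [delta * pi A * nu <= pi], and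
   [a_n = nu Q^n h - 1]. By reversibility [a_n] is the variance of [P^n h] under
   [pi], so [a_n >= 0]; therefore [a_n] is at most its convolution with the
   survival sequence [nu rho_k], and the renewal equation bounds that convolution
   by [pi rho_(n+1) / (b * pi A)]. This gives the exact rate without analytic
   continuation, and [|nu P^n f - pi f|^2 <= a_n] for [|f| <= 1].

   For the pointwise bound, [Gamma (P - c 1_A nu) v <= q v] on [A], [c = sqrt b],
   holds with some [q < 1] strictly for [v = V^s], where [V x = E_x[kappa^t]] and
   [t >= 0] is the hitting time of [A]: the bound for [Q] factors as [q] times a
   number greater than [1]. This slack lets the
   drift inequality absorb the error [c |nu P^n f - pi f|] at every visit to [A],
   so [|P^n f x - pi f| <= C * v x * Gamma^(-n)]; finally [v] is finite [pi]-almost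
   everywhere by irreducibility. *)

Require Import Defs.
From HB Require Import structures.
From mathcomp Require Import all_boot all_order all_algebra.
From mathcomp Require Import all_classical all_reals all_analysis.
From mathcomp Require Import measurable_realfun.
From mathcomp Require Import ring lra.

Set Implicit Arguments.
Unset Strict Implicit.
Unset Printing Implicit Defensive.

Import Order.TTheory GRing.Theory Num.Theory.
Import numFieldNormedType.Exports.

Local Open Scope classical_set_scope.
Local Open Scope ring_scope.
Local Open Scope ereal_scope.

(** * Monotone functionals on nonnegative functions *)

Section integral_like.
Context d (T : measurableType d) (R : realType).
Implicit Types (f g : T -> \bar R) (I J : (T -> \bar R) -> \bar R).

Definition nnmeas f := measurable_fun [set: T] f /\ forall x, 0 <= f x.

Lemma nnmeas_ge0 f x : nnmeas f -> 0 <= f x. Proof. by case. Qed.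

(** These four properties pass from integrals to image measures, weighted measures and kernels, and
    they determine the functional by its values on indicators. Identities and inequalities between
    measures can so be checked on measurable sets only. *)
Record integral_like I : Prop := IntegralLike {
  il_add : forall f g, nnmeas f -> nnmeas g ->
    I (fun x => f x + g x) = I f + I g;
  il_scale : forall (c : R) f, (0 <= c)%R -> nnmeas f ->
    I (fun x => c%:E * f x) = c%:E * I f;
  il_le : forall f g, nnmeas f -> nnmeas g -> (forall x, f x <= g x) ->
    I f <= I g;
  il_cvg : forall h : nat -> T -> \bar R, (forall n, nnmeas (h n)) ->
    (forall x, nondecreasing_seq (h ^~ x)) ->
    I (fun x => limn (h ^~ x)) = limn (I \o h) }.

Lemma nnmeas_indic (B : set T) : measurable B ->
  nnmeas (fun x => (\1_B x : R)%:E).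
Proof.
by move=> mB; split=> [|x]; [exact/measurable_EFinP|rewrite lee_fin].
Qed.

Lemma nnmeasD f g : nnmeas f -> nnmeas g -> nnmeas (fun x => f x + g x).
Proof.
move=> [mf f0] [mg g0]; split=> [|x]; first exact: emeasurable_funD.
exact: adde_ge0.
Qed.

Lemma nnmeasM f g : nnmeas f -> nnmeas g -> nnmeas (fun x => f x * g x).
Proof.
move=> [mf f0] [mg g0]; split=> [|x]; first exact: emeasurable_funM.
exact: mule_ge0.
Qed.

Lemma nnmeas_cst (c : \bar R) : 0 <= c -> nnmeas (fun=> c).
Proof. by move=> c0; split. Qed.

Lemma nnmeasZ (c : R) f : (0 <= c)%R -> nnmeas f -> nnmeas (fun x => c%:E * f x).
Proof. by move=> c0; apply/nnmeasM/nnmeas_cst; rewrite lee_fin. Qed.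

Lemma nnmeas_sum (h : nat -> T -> \bar R) n : (forall k, nnmeas (h k)) ->
  nnmeas (fun x => \sum_(0 <= k < n) h k x).
Proof.
move=> hh; split=> [|x]; first by apply: emeasurable_sum => k; case: (hh k).
by apply: sume_ge0 => k _; case: (hh k).
Qed.

Lemma nnmeas_series (h : nat -> T -> \bar R) : (forall k, nnmeas (h k)) ->
  nnmeas (fun x => \sum_(0 <= k <oo) h k x).
Proof.
move=> hh; split=> [|x]; last by apply: nneseries_ge0 => k _ _; case: (hh k).
by apply: ge0_emeasurable_sum => [k x _ _|k _]; case: (hh k).
Qed.

(** Stands in for the subtraction [g - f], meaningless where both are infinite; the difference is
    put to 0 where [f] is [+oo]. Applying an [integral_like] functional to [g = f + w] then needs no
    finiteness. *)
Lemma nnmeas_complement f g : nnmeas f -> nnmeas g -> (forall x, f x <= g x) ->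
  exists2 w, nnmeas w & forall x, g x = f x + w x.
Proof.
move=> [mf f0] [mg g0] fg.
exists (fun x => if f x == +oo then 0 else g x - f x); last first.
  move=> x; case: ifPn => [/eqP fy|fny].
    by move: (fg x); rewrite fy leye_eq => /eqP ->; rewrite adde0.
  by rewrite addeCA subee ?adde0// ge0_fin_numE// ltey.
split=> [|x].
  apply: measurable_fun_ifT => //; last exact: emeasurable_funB.
  apply: (measurable_fun_bool true); rewrite setTI.
  rewrite (_ : _ @^-1` _ = [set: T] `&` f @^-1` [set +oo]); first exact: mf.
  by rewrite setTI; apply/seteqP; split=> x /= /eqP.
case: ifPn => // fny; rewrite sube_ge0 ?(fg x)// ge0_fin_numE// ltey.
by rewrite fny.
Qed.

Lemma il0 I : integral_like I -> I (fun=> 0) = 0.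
Proof.
move=> iI; have := il_scale iI (lexx 0%R) (nnmeas_cst (lexx 0)).
by under eq_fun do rewrite mul0e; rewrite mul0e.
Qed.

Lemma il_ge0 I f : integral_like I -> nnmeas f -> 0 <= I f.
Proof.
move=> iI nf; rewrite -(il0 iI); apply: (il_le iI) => // x.
exact: nnmeas_ge0.
Qed.

Lemma il_sum I (h : nat -> T -> \bar R) n : integral_like I ->
  (forall k, nnmeas (h k)) ->
  I (fun x => \sum_(0 <= k < n) h k x) = \sum_(0 <= k < n) I (h k).
Proof.
move=> iI hh; elim: n => [|n ih].
  under eq_fun do rewrite big_nil.
  by rewrite il0// big_nil.
under eq_fun do rewrite big_nat_recr//=.
by rewrite il_add//; [rewrite ih big_nat_recr|exact: nnmeas_sum].
Qed.

Lemma il_series I (h : nat -> T -> \bar R) : integral_like I ->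
  (forall k, nnmeas (h k)) ->
  I (fun x => \sum_(0 <= k <oo) h k x) = \sum_(0 <= k <oo) I (h k).
Proof.
move=> iI hh.
rewrite (il_cvg iI (h := fun n x => \sum_(0 <= k < n) h k x)).
- by congr (limn _); apply/funext => n /=; rewrite il_sum.
- by move=> n; exact: nnmeas_sum.
- move=> x; apply: ereal_nondecreasing_series => k _ _.
  by case: (hh k).
Qed.

Import HBNNSimple.

(** Simple functions increasing to [f] reduce the claim, by monotone limits, to finite sums of
    multiples of indicators. *)
Lemma integral_like_le I J : integral_like I -> integral_like J ->
  (forall B, measurable B ->
     I (fun x => (\1_B x)%:E) <= J (fun x => (\1_B x)%:E)) ->
  forall f, nnmeas f -> I f <= J f.
Proof.
move=> iI iJ IJ f [mf f0].
pose h n x := (nnsfun_approx measurableT mf n x)%:E.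
have hh n : nnmeas (h n).
  by split=> [|x]; [exact/measurable_EFinP|rewrite lee_fin].
have ndh x : nondecreasing_seq (h ^~ x).
  by move=> m n mn; rewrite lee_fin; exact/lefP/nd_nnsfun_approx.
have -> : f = (fun x => limn (h ^~ x)).
  by apply/funext => x; apply/esym/cvg_lim => //; exact: cvg_nnsfun_approx.
rewrite (il_cvg iI)// (il_cvg iJ)//; apply: lee_lim.
- by apply: ereal_nondecreasing_is_cvgn => m n mn; apply: (il_le iI) => // x; exact: ndh.
- by apply: ereal_nondecreasing_is_cvgn => m n mn; apply: (il_le iJ) => // x; exact: ndh.
apply: nearW => n /=; rewrite /h; move: (nnsfun_approx _ _ n) => {h hh ndh}g.
pose t r x := (r%:E * (\1_(g @^-1` [set r]) x)%:E : \bar R).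
have tt r : (0 <= r)%R -> nnmeas (t r).
  by move=> r0; apply: nnmeasZ => //; exact: nnmeas_indic.
have [s [s0 gs]] : exists s : seq R, (all (fun r => 0 <= r)%R s) /\
    forall x, (g x)%:E = \sum_(r <- s) t r x.
  (* Negative values may be dropped because their level sets are empty; only nonnegative scalars are
     allowed in [il_scale]. *)
  exists [seq r <- finmap.enum_fset (fset_set (range g)) | (0 <= r)%R]; split.
    exact: filter_all.
  move=> x; rewrite fimfunE -fsumEFin// fsbig_finite//= big_filter [RHS]big_mkcond/=.
  apply: eq_bigr => r _; rewrite EFinM; case: ifPn => // /negP r0.
  rewrite indicE; case: (boolP (x \in _)); last by rewrite mule0.
  by rewrite inE/= => gr; case: r0; rewrite -gr.
have ns s' : (all (fun r => 0 <= r)%R s') ->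
    nnmeas (fun x => \sum_(r <- s') t r x).
  elim: s' => [_|r s' ih /= /andP[r0 s'0]].
    by under eq_fun do rewrite big_nil; exact: nnmeas_cst.
  by under eq_fun do rewrite big_cons; apply: nnmeasD; [exact: tt|exact: ih].
rewrite (_ : (fun x => (g x)%:E) = (fun x => \sum_(r <- s) t r x)); last exact/funext.
elim: s s0 {gs} => [_|r s ih /= /andP[r0 s0]].
  under eq_fun do rewrite big_nil.
  by rewrite !il0.
under eq_fun do rewrite big_cons.
rewrite (il_add iI) ?(il_add iJ)//; [|exact: tt|exact: ns|exact: tt|exact: ns].
apply: leeD; last exact: ih.
rewrite /t (il_scale iI)// ?(il_scale iJ)//; [|exact: nnmeas_indic..].
by apply: lee_wpmul2l; [rewrite lee_fin|exact: IJ].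
Qed.

Lemma integral_like_eq I J : integral_like I -> integral_like J ->
  (forall B, measurable B ->
     I (fun x => (\1_B x)%:E) = J (fun x => (\1_B x)%:E)) ->
  forall f, nnmeas f -> I f = J f.
Proof.
move=> iI iJ IJ f nf; apply/eqP; rewrite eq_le.
by rewrite !integral_like_le// => B mB; rewrite IJ.
Qed.

End integral_like.

(** * Integrals, image measures, densities and kernels as monotone functionals *)

Section integral_like_instances.
Context (R : realType).

Lemma il_integral d (T : measurableType d) (mu : {measure set T -> \bar R})
    (D : set T) : measurable D -> integral_like (fun f => \int[mu]_(x in D) f x).
Proof.
move=> mD; have S f : nnmeas f -> measurable_fun D f.
  by case=> mf _; exact: measurable_funTS.
split.
- by move=> f g nf ng; apply: ge0_integralD => //;
    [move=> x _; case: nf|exact: S|move=> x _; case: ng|exact: S].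
- by move=> c f c0 nf; apply: ge0_integralZl => //;
    [exact: S|move=> x _; case: nf].
- move=> f g nf ng fg; apply: ge0_le_integral => //.
  + by move=> x _; case: nf.
  + exact: S.
  + exact: S.
- move=> h nh ndh; rewrite monotone_convergence//.
  + by move=> n; exact: S.
  + by move=> n x _; case: (nh n).
Qed.

Lemma il_comp d d' (T : measurableType d) (T' : measurableType d') (phi : T -> T')
    (I : (T -> \bar R) -> \bar R) : measurable_fun [set: T] phi ->
  integral_like I -> integral_like (fun f => I (f \o phi)).
Proof.
move=> mphi iI.
have S f : nnmeas f -> nnmeas (f \o phi).
  by case=> mf f0; split=> [|x]; [exact: measurableT_comp|exact: f0].
split.
- by move=> f g nf ng; rewrite -(il_add iI)//; exact: S.
- by move=> c f c0 nf; rewrite -(il_scale iI)//; exact: S.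
- by move=> f g nf ng fg; apply: (il_le iI) => [||x]; [exact: S|exact: S|exact: fg].
- by move=> h nh ndh; rewrite -[RHS](il_cvg iI (h := fun n => h n \o phi)) => [|n|x];
    [|exact: S|exact: ndh].
Qed.

Lemma il_weight d (T : measurableType d) (g : T -> R)
    (I : (T -> \bar R) -> \bar R) : measurable_fun [set: T] g ->
  (forall x, 0 <= g x)%R ->
  integral_like I -> integral_like (fun f => I (fun x => (g x)%:E * f x)).
Proof.
move=> mg g0 iI.
have S f : nnmeas f -> nnmeas (fun x => (g x)%:E * f x).
  by apply: nnmeasM; split=> [|x]; [exact/measurable_EFinP|rewrite lee_fin].
split.
- move=> f h nf nh; rewrite -(il_add iI)//; [|exact: S..].
  by congr I; apply/funext => x; rewrite ge0_muleDr//; [case: nf|case: nh].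
- move=> c f c0 nf; rewrite -(il_scale iI)//; last exact: S.
  by congr I; apply/funext => x; rewrite muleCA.
- move=> f h nf nh fh; apply: (il_le iI) => [||x]; [exact: S|exact: S|].
  by apply: lee_wpmul2l => //; rewrite lee_fin.
- move=> h nh ndh; rewrite -[RHS](il_cvg iI (h := fun n x => (g x)%:E * h n x)).
  + congr I; apply/funext => x; rewrite limeMl//.
    exact: ereal_nondecreasing_is_cvgn.
  + by move=> n; exact: S.
  + by move=> x m n mn; apply: lee_wpmul2l; rewrite ?lee_fin//; exact: ndh.
Qed.

Section kernel.
Context d d' (X : measurableType d) (Y : measurableType d').
Variable k : R.-pker X ~> Y.

Definition kmean (f : Y -> \bar R) (x : X) : \bar R := \int[k x]_y f y.

Lemma nnmeas_kmean f : nnmeas f -> nnmeas (kmean f).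
Proof.
case=> mf f0; split=> [|x]; last by apply: integral_ge0.
by apply: measurable_fun_integral_kernel => // U mU; exact: measurable_kernel.
Qed.

(** For [I] the integral against a measure, this is the integral against its image under the kernel;
    multi-step kernels are handled in this way, as iterated operators. *)
Lemma il_kmean I : integral_like I -> integral_like (I \o kmean).
Proof.
move=> iI; have K x : integral_like (fun f => kmean f x).
  exact: il_integral.
split=> /=.
- move=> f g nf ng; rewrite -(il_add iI)//; [|exact: nnmeas_kmean..].
  by congr I; apply/funext => x; rewrite (il_add (K x)).
- move=> c f c0 nf; rewrite -(il_scale iI)//; last exact: nnmeas_kmean.
  by congr I; apply/funext => x; rewrite (il_scale (K x)).
- move=> f g nf ng fg; apply: (il_le iI) => [||x]; [exact: nnmeas_kmean..|].
  exact: (il_le (K x)).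
- move=> h nh ndh; rewrite -[RHS](il_cvg iI (h := kmean \o h)).
  + by congr I; apply/funext => x; rewrite (il_cvg (K x)).
  + by move=> n; exact: nnmeas_kmean.
  + by move=> x m n mn; apply: (il_le (K x)) => // y; exact: ndh.
Qed.

End kernel.
End integral_like_instances.

(** * Expectations of bounded real functions *)

Section mean.
Context d (X : measurableType d) (R : realType).
Implicit Types (f g : X -> R).
Local Open Scope ring_scope.

Definition bmeas f := measurable_fun [set: X] f /\ exists M, forall x, `|f x| <= M.

Lemma bmeas_cst (c : R) : bmeas (fun=> c).
Proof. by split=> //; exists `|c|. Qed.

Lemma bmeasD f g : bmeas f -> bmeas g -> bmeas (fun x => f x + g x).
Proof.
move=> [mf [M fM]] [mg [N gN]]; split; first exact: measurable_funD.
by exists (M + N) => x; rewrite (le_trans (ler_normD _ _))// lerD.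
Qed.

Lemma bmeasM f g : bmeas f -> bmeas g -> bmeas (fun x => f x * g x).
Proof.
move=> [mf [M fM]] [mg [N gN]]; split; first exact: measurable_funM.
by exists (M * N) => x; rewrite normrM ler_pM.
Qed.

Lemma bmeasZ (c : R) f : bmeas f -> bmeas (fun x => c * f x).
Proof. by move=> bf; apply: bmeasM => //; exact: bmeas_cst. Qed.

Lemma bmeasN f : bmeas f -> bmeas (fun x => - f x).
Proof.
by move=> bf; under eq_fun do rewrite -mulN1r; exact: bmeasZ.
Qed.

Lemma bmeasB f g : bmeas f -> bmeas g -> bmeas (fun x => f x - g x).
Proof. by move=> bf bg; apply: bmeasD => //; exact: bmeasN. Qed.

Lemma bmeas_norm f : bmeas f -> bmeas (fun x => `|f x|).
Proof.
move=> [mf [M fM]]; split; first exact: measurableT_comp.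
by exists M => x; rewrite normr_id.
Qed.

Lemma bmeas_indic (B : set X) : measurable B -> bmeas (\1_B : X -> R).
Proof.
move=> mB; split; first exact: measurable_indic.
by exists 1 => x; rewrite indicE normr_nat; case: (x \in B); rewrite ?ler01.
Qed.

(** On bounded real functions subtraction is available. The renewal and variance arguments are
    purely algebraic and rest on linearity, positivity and normalization. *)
Record mean (I : (X -> R) -> R) : Prop := Mean {
  mean_add : forall f g, bmeas f -> bmeas g ->
    I (fun x => f x + g x) = I f + I g;
  mean_scale : forall (c : R) f, bmeas f -> I (fun x => c * f x) = c * I f;
  mean_ge0 : forall f, bmeas f -> (forall x, 0 <= f x) -> 0 <= I f;
  mean_cst : forall c : R, I (fun=> c) = c }.

Lemma mean_opp I f : mean I -> bmeas f -> I (fun x => - f x) = - I f.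
Proof.
by move=> mI bf; under eq_fun do rewrite -mulN1r; rewrite mean_scale// mulN1r.
Qed.

Lemma mean_sub I f g : mean I -> bmeas f -> bmeas g ->
  I (fun x => f x - g x) = I f - I g.
Proof.
by move=> mI bf bg; rewrite mean_add ?mean_opp//; exact: bmeasN.
Qed.

Lemma mean_le I f g : mean I -> bmeas f -> bmeas g -> (forall x, f x <= g x) ->
  I f <= I g.
Proof.
move=> mI bf bg fg; rewrite -subr_ge0 -mean_sub//.
by apply: (mean_ge0 mI) => [|x]; [exact: bmeasB|rewrite subr_ge0].
Qed.

Lemma mean_norm_le I f (M : R) : mean I -> bmeas f -> (forall x, `|f x| <= M) ->
  `|I f| <= M.
Proof.
move=> mI bf fM; rewrite ler_norml; apply/andP; split.
  rewrite -[leLHS](mean_cst mI); apply: (mean_le mI) => //; first exact: bmeas_cst.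
  by move=> x; have := fM x; rewrite ler_norml => /andP[].
rewrite -[leRHS](mean_cst mI); apply: (mean_le mI) => //; first exact: bmeas_cst.
by move=> x; have := fM x; rewrite ler_norml => /andP[].
Qed.

Lemma mean_comp I (J : (X -> R) -> X -> R) : mean I ->
  (forall f, bmeas f -> bmeas (J f)) -> (forall x, mean (J ^~ x)) ->
  mean (I \o J).
Proof.
move=> mI bJ mJ; split=> /=.
- move=> f g bf bg; rewrite -(mean_add mI); [|exact: bJ..].
  by congr I; apply/funext => x; rewrite (mean_add (mJ x)).
- move=> c f bf; rewrite -(mean_scale mI); last exact: bJ.
  by congr I; apply/funext => x; rewrite (mean_scale (mJ x)).
- by move=> f bf f0; apply: (mean_ge0 mI) => [|x]; [exact: bJ|exact: mean_ge0 (mJ x) _ _ _].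
- move=> c; rewrite -[RHS](mean_cst mI).
  by congr I; apply/funext => x; rewrite (mean_cst (mJ x)).
Qed.

Section measure.
Variable mu : {measure set X -> \bar R}.
Hypothesis mu1 : (mu setT = 1)%E.

Lemma bmeas_integrable f : bmeas f -> mu.-integrable [set: X] (EFin \o f).
Proof.
move=> [mf [M fM]]; apply: measurable_bounded_integrable => //.
  by rewrite mu1 ltry.
by exists M; split=> [|N MN x _]; [exact: num_real|exact: le_trans (fM x) (ltW MN)].
Qed.

Lemma mean_Rintegral : mean (fun f => \int[mu]_x f x).
Proof.
split.
- by move=> f g bf bg; rewrite RintegralD//; exact: bmeas_integrable.
- by move=> c f bf; rewrite RintegralZl//; exact: bmeas_integrable.
- by move=> f bf f0; apply: Rintegral_ge0.
- by move=> c; rewrite Rintegral_cst// mu1 mulr1.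
Qed.

Lemma EFin_Rintegral f : bmeas f ->
  ((\int[mu]_x f x)%:E = \int[mu]_x (f x)%:E)%E.
Proof.
move=> bf; rewrite /Rintegral fineK//.
exact: (integrable_fin_num _ (bmeas_integrable bf)).
Qed.

End measure.

End mean.

(** * Taboo probabilities of the chain *)

Section taboo.
Context d (X : measurableType d) (R : realType) (P : R.-pker X ~> X) (A : set X).

(** One step of the chain killed on entering [A]. Its [n]-th iterate applied to [f] is the
    expectation of [f (Phi n)] on the event that the return time exceeds [n]. *)
Definition taboo (f : X -> \bar R) : X -> \bar R :=
  kmean P (fun y => (\1_(~` A) y : R)%:E * f y).

Hypothesis mA : measurable A.

Lemma nnmeas_taboo f : nnmeas f -> nnmeas (taboo f).
Proof.
move=> nf; apply/nnmeas_kmean/nnmeasM => //; apply: nnmeas_indic.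
exact: measurableC.
Qed.

Lemma nnmeas_iter_taboo n f : nnmeas f -> nnmeas (iter n taboo f).
Proof. by move=> nf; elim: n => //= n; exact: nnmeas_taboo. Qed.

Lemma il_taboo x : integral_like (taboo ^~ x).
Proof.
apply: (il_weight (I := kmean P ^~ x)).
- by apply: measurable_indic; exact: measurableC.
- by [].
- exact: il_integral.
Qed.

End taboo.

(** * From events on paths to iterates of kernels *)

Section chain_facts.
Context d (X : measurableType d) (R : realType) dO (Omega : measurableType dO).
Variables (Phi : nat -> {mfun Omega >-> X}) (Pr : X -> probability Omega R).
Variables (P : R.-pker X ~> X).
Hypothesis hPhi : markov_chain Phi Pr P.

Lemma history_measurable n E : history Phi n E -> measurable E.
Proof.
apply: smallest_sub; first exact: sigma_algebra_measurable.
by move=> _ [k _ [B mB <-]]; exact: measurable_funP.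
Qed.

Lemma historyT n : history Phi n setT.
Proof.
rewrite -(setD0 setT); apply: sigma_algebraCD; exact: sigma_algebra0.
Qed.

Lemma historyS n : history Phi n `<=` history Phi n.+1.
Proof.
apply: sub_sigma_algebra2 => E [k /= kn hE]; exists k => //=.
exact: leq_trans kn _.
Qed.

Lemma history_preimage n B : measurable B -> history Phi n (Phi n @^-1` B).
Proof.
move=> mB; apply: sub_sigma_algebra; exists n => //=.
by exists B => //; rewrite setTI.
Qed.

Lemma historyI n E F : history Phi n E -> history Phi n F ->
  history Phi n (E `&` F).
Proof.
exact: (@measurableI _ (g_sigma_algebraType _) E F).
Qed.

(** The Markov property is given for indicators of sets; both sides are monotone functionals of [f],
    so it extends. *)
Lemma markov_integral n x E f : history Phi n E -> nnmeas f ->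
  \int[Pr x]_(w in E) f (Phi n.+1 w) = \int[Pr x]_(w in E) kmean P f (Phi n w).
Proof.
move=> hE nf; have mE := history_measurable hE.
have mPhi k : measurable_fun [set: Omega] (Phi k) by exact: measurable_funP.
pose I h := \int[Pr x]_(w in E) h w.
have iI : integral_like I by exact: il_integral.
have iL := il_comp (mPhi n.+1) iI.
have iR := il_kmean P (il_comp (mPhi n) iI).
apply: (integral_like_eq iL iR) nf => B mB.
transitivity (\int[Pr x]_(w in E) (\1_(Phi n.+1 @^-1` B) w)%:E); first by [].
rewrite integral_indic//; last by rewrite -[X in measurable X]setTI; exact: mPhi.
rewrite setIC; apply: etrans (proj2 hPhi x n E B hE mB) _.
apply: eq_integral => w _ /=; by rewrite /kmean integral_indic// setIT.
Qed.

Lemma start_integral x f : nnmeas f -> \int[Pr x]_w f (Phi 0%N w) = f x.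
Proof.
have mPhi : measurable_fun [set: Omega] (Phi 0%N) by exact: measurable_funP.
have iL := il_comp mPhi (il_integral (Pr x) measurableT).
have iR : integral_like (fun f : X -> \bar R => f x) by split.
apply: (integral_like_eq iL iR) => B mB /=.
transitivity (\int[Pr x]_w (\1_(Phi 0%N @^-1` B) w)%:E); first by [].
rewrite integral_indic ?setIT//; last by rewrite -[X in measurable X]setTI; exact: mPhi.
exact: (proj1 hPhi).
Qed.

Lemma nstep_integral n x f : nnmeas f ->
  \int[nstep Phi Pr n x]_y f y = iter n (kmean P) f x.
Proof.
move=> nf; have -> : \int[nstep Phi Pr n x]_y f y = \int[Pr x]_w f (Phi n w).
  case: (nf) => mf f0; rewrite /nstep /distribution.
  by rewrite ge0_integral_pushforward.
elim: n f nf => [|n ih] f nf; first exact: start_integral.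
rewrite (markov_integral x (@historyT n) nf) iterSr ih//.
exact: nnmeas_kmean.
Qed.

Section hitting.
Variable A : set X.
Hypothesis mA : measurable A.

(** The event that the return time to [A] exceeds [n]; it lies in the history up to [n], so the
    Markov property can be used on it. *)
Definition avoids n : set Omega :=
  [set w | forall k, (1 <= k <= n)%N -> ~ A (Phi k w)].

Lemma avoids0 : avoids 0 = setT.
Proof. by apply/seteqP; split=> // w _ [|k]. Qed.

Lemma avoidsS n : avoids n.+1 = avoids n `&` Phi n.+1 @^-1` (~` A).
Proof.
apply/seteqP; split=> w /= => [h|[h nA] k /andP[k1]].
  split=> [k /andP[k1 kn]|]; last by apply: h; rewrite ltnS leqnn.
  by apply: h; rewrite k1 (leq_trans kn).
by rewrite leq_eqVlt => /predU1P[->//|kn]; apply: h; rewrite k1.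
Qed.

Lemma history_avoids n : history Phi n (avoids n).
Proof.
elim: n => [|n ih]; first by rewrite avoids0; exact: historyT.
rewrite avoidsS; apply: historyI; first exact: historyS.
by apply: history_preimage; exact: measurableC.
Qed.

Lemma measurable_avoids n : measurable (avoids n).
Proof. exact: history_measurable (@history_avoids n). Qed.

(** Induction that peels off the last step: the condition of being off [A] at time [n + 1] becomes
    the weight inside [taboo]. *)
Lemma avoids_integral n x f : nnmeas f ->
  \int[Pr x]_(w in avoids n) f (Phi n w) = iter n (taboo P A) f x.
Proof.
elim: n f => [|n ih] f nf; first by rewrite avoids0 start_integral.
rewrite iterSr -ih; last exact: nnmeas_taboo.
rewrite /taboo -markov_integral; [|exact: history_avoids|]; last first.
  by apply: nnmeasM => //; apply: nnmeas_indic; exact: measurableC.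
rewrite avoidsS integral_mkcondr; apply: eq_integral => w _.
have [Aw|nAw] := pselect (A (Phi n.+1 w)).
  by rewrite patchE indicE !memNset ?mul0e//=; apply.
by rewrite patchE indicE !mem_set// mul1e.
Qed.

Lemma avoids_prob n x : Pr x (avoids n) = iter n (taboo P A) (cst 1) x.
Proof.
rewrite -avoids_integral; last exact: nnmeas_cst.
by rewrite integral_cst ?mul1e//; exact: measurable_avoids.
Qed.

(** The infimum is either attained at a positive integer or [+oo]; in both cases [avoids n] says
    that [n] is smaller than it. *)
Lemma return_timeP w :
  (exists N, [/\ A (Phi N.+1 w), return_time R Phi A w = N.+1%:R%:E &
     forall n, (n <= N)%N <-> avoids n w]) \/
  (return_time R Phi A w = +oo /\ forall n, avoids n w).
Proof.
have [[N0 [N0_gt0 AN0]]|noA] := pselect (exists k, (1 <= k)%N /\ A (Phi k w)).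
  left; pose p k := (1 <= k)%N && `[< A (Phi k w) >].
  have exp : exists k, p k by exists N0; rewrite /p N0_gt0; exact/asboolP.
  case: (ex_minnP exp) => -[|N] //; rewrite {1}/p /= => /asboolP AN minN.
  exists N; split=> //.
  - apply/eqP; rewrite eq_le; apply/andP; split.
      by apply: ereal_inf_lbound; exists N.+1.
    apply: le_ereal_inf_tmp => _ [k /= [k0 Ak] <-].
    by rewrite lee_fin ler_nat; apply: minN; rewrite /p k0; exact/asboolP.
  - move=> n; split=> [nN k /andP[k1 kn] Ak|avn].
      have : (N < k)%N by apply: minN; rewrite /p k1; exact/asboolP.
      by rewrite ltnNge (leq_trans kn nN).
    by rewrite leqNgt; apply/negP => Nn; apply: (avn N.+1) AN; rewrite Nn.
right; split.
  rewrite /return_time (_ : [set _ | _ in _] = set0) ?ereal_inf0//.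
  by rewrite -subset0 => t [k hk _]; exfalso; apply: noA; exists k.
by move=> n k /andP[k1 _] Ak; apply: noA; exists k.
Qed.

Lemma first_returnE n x : first_return Phi Pr n.+1 x A =
  iter n (taboo P A) (kmean P (fun y => (\1_A y)%:E)) x.
Proof.
rewrite -avoids_integral; last exact/nnmeas_kmean/nnmeas_indic.
rewrite -markov_integral; [|exact: history_avoids|exact: nnmeas_indic].
have mPhi : measurable (Phi n.+1 @^-1` A).
  by rewrite -[X in measurable X]setTI; exact: measurable_funP.
rewrite (_ : (fun w => (\1_A (Phi n.+1 w))%:E) =
  (fun w => (\1_(Phi n.+1 @^-1` A) w)%:E))// integral_indic//; last first.
  exact: measurable_avoids.
congr (Pr x _); apply/seteqP; split=> w /=.
  case: (return_timeP w) => [[N [AN -> hN]]|[-> //]].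
  by move=> [/eqP]; rewrite eqr_nat => /eqP[<-]; split=> //; apply/hN.
move=> [Aw avw]; case: (return_timeP w) => [[N [AN -> hN]]|[_ /(_ n.+1)]].
  congr (_%:R%:E); apply/eqP; rewrite eqSS eqn_leq.
  rewrite (proj2 (hN n) avw) andbT leqNgt; apply/negP => nN.
  by move: (proj1 (hN n.+1) nN) => /(_ n.+1); rewrite leqnn; exact.
by move=> /(_ n.+1); rewrite leqnn => /(_ isT).
Qed.

Variable kappa : R.
Hypothesis kappa1 : (1 < kappa)%R.

(* [kappa ^ t = 1 + (kappa - 1) * \sum_(n < t) kappa ^ n], including [t = +oo]. *)
Lemma pow_ext_return_time w : pow_ext kappa (return_time R Phi A w) =
  1 + \sum_(0 <= n <oo) ((kappa - 1) * kappa ^+ n)%:E * (\1_(avoids n) w)%:E.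
Proof.
have k0 : (0 < kappa)%R by rewrite (lt_trans _ kappa1).
have c0 n : (0 <= (kappa - 1) * kappa ^+ n)%R.
  by rewrite mulr_ge0 ?exprn_ge0 ?subr_ge0// ltW.
have sumE N : (\sum_(0 <= n < N) ((kappa - 1) * kappa ^+ n) = kappa ^+ N - 1)%R.
  by rewrite -big_distrr/= subrX1 big_mkord.
case: (return_timeP w) => [[N [_ -> hN]]|[-> hN]] /=.
  rewrite (nneseries_split 0%N N.+1); last by move=> k _; rewrite mule_ge0 ?lee_fin.
  rewrite [X in _ + (_ + X)]eseries0 ?adde0; last first.
    move=> k Nk _; rewrite indicE memNset ?mule0// => /hN.
    by rewrite leqNgt Nk.
  rewrite add0n (eq_big_nat _ _ (F2 := fun n => ((kappa - 1) * kappa ^+ n)%:E)).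
    by rewrite sumEFin sumE -EFinD addrC subrK powR_mulrn// ltW.
  by move=> k /andP[_ kN]; rewrite indicE mem_set ?mule1//; apply/hN.
rewrite (eq_eseriesr (g := fun n => ((kappa - 1) * kappa ^+ n)%:E)); last first.
  by move=> n _; rewrite indicE mem_set ?mule1.
apply/esym/eqyP => M M0.
apply: (@le_trans _ _ (\sum_(0 <= n <oo) ((kappa - 1) * kappa ^+ n)%:E)); last first.
  by rewrite leeDr.
(* For an infinite return time the series must exceed every [M]: by Bernoulli's inequality [B] the
   first [N] terms already do. *)
pose N := Num.bound (M / (kappa - 1)).
apply: le_trans (nneseries_lim_ge N _) => [|n _ _]; last by rewrite lee_fin.
rewrite sumEFin sumE lee_fin.
have km1 : (0 < kappa - 1)%R by rewrite subr_gt0.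
have B n : (n%:R * (kappa - 1) <= kappa ^+ n - 1)%R.
  elim: n => [|n ih]; first by rewrite mul0r expr0 subrr.
  have : (1 <= kappa ^+ n)%R by rewrite exprn_ege1// ltW.
  rewrite exprS -natr1; nra.
apply: le_trans (B N); rewrite -ler_pdivrMr//.
by apply/ltW/archi_boundP/divr_ge0; exact: ltW.
Qed.

(** The moment of order [kappa] of the return time, summed by parts over its tail probabilities;
    this form involves the kernel only and not the paths. *)
Definition exit_moment (x : X) : \bar R :=
  1 + \sum_(0 <= n <oo)
    ((kappa - 1) * kappa ^+ n)%:E * iter n (taboo P A) (cst 1) x.

Lemma return_momentE x : return_moment Phi Pr kappa A x = exit_moment x.
Proof.
have c0 n : (0 <= (kappa - 1) * kappa ^+ n)%R.
  by rewrite mulr_ge0 ?exprn_ge0 ?subr_ge0 ?(ltW kappa1)// ltW ?(lt_trans _ kappa1).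
have na n : nnmeas (fun w => ((kappa - 1) * kappa ^+ n)%:E * (\1_(avoids n) w)%:E).
  by apply: nnmeasZ => //; apply: nnmeas_indic; exact: measurable_avoids.
have iI := il_integral (Pr x) measurableT.
rewrite /return_moment; under eq_integral do rewrite pow_ext_return_time.
rewrite (il_add iI (nnmeas_cst _ lee01) (nnmeas_series na)) (il_series iI)//.
rewrite integral_cst// mul1e; congr (_ + _); first exact: probability_setT.
apply: eq_eseriesr => n _; rewrite (il_scale iI)//; last first.
  by apply: nnmeas_indic; exact: measurable_avoids.
rewrite integral_indic//; last exact: measurable_avoids.
by rewrite setIT; congr (_ * _); exact: avoids_prob.
Qed.

End hitting.
End chain_facts.

(** * Drift functions *)

Section drift.
Context d (X : measurableType d) (R : realType) (P : R.-pker X ~> X) (A : set X).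
Hypothesis mA : measurable A.
Variable kappa : R.
Hypothesis kappa1 : (1 < kappa)%R.

Let k0 : (0 <= kappa)%R. Proof. by rewrite ltW// (lt_trans _ kappa1). Qed.
Let mAc : measurable (~` A). Proof. exact: measurableC. Qed.
Let K := taboo P A.
Let p1 := kmean P (fun y => (\1_A y : R)%:E).
Let S x := \sum_(0 <= n <oo)
  ((kappa - 1) * kappa ^+ n)%:E * iter n K (cst 1) x.
Let m := exit_moment P A kappa.

Let il_K x : integral_like (K ^~ x). Proof. exact: il_taboo. Qed.
Let il_P x : integral_like (kmean P ^~ x). Proof. exact: il_integral. Qed.
Let n1 : nnmeas (fun x : X => (\1_A x : R)%:E). Proof. exact: nnmeas_indic. Qed.
Let n1c : nnmeas (fun x : X => (\1_(~` A) x : R)%:E). Proof. exact: nnmeas_indic. Qed.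
Let nK f : nnmeas f -> nnmeas (K f). Proof. exact: nnmeas_taboo. Qed.
Let nKn n f : nnmeas f -> nnmeas (iter n K f).
Proof. exact: nnmeas_iter_taboo. Qed.
Let np1 : nnmeas p1. Proof. exact: nnmeas_kmean. Qed.
Let nc1 : nnmeas (cst 1 : X -> \bar R). Proof. exact: nnmeas_cst. Qed.

Let c0 n : (0 <= (kappa - 1) * kappa ^+ n)%R.
Proof. by rewrite mulr_ge0 ?exprn_ge0// subr_ge0 ltW. Qed.

Let nS : nnmeas S.
Proof. by apply: nnmeas_series => n; apply: nnmeasZ => //; exact: nKn. Qed.

Lemma nnmeas_exit_moment : nnmeas m.
Proof. exact: (nnmeasD nc1 nS). Qed.
Let nm := nnmeas_exit_moment.

Lemma exit_moment_ge1 x : 1 <= m x.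
Proof. by rewrite /m/exit_moment leeDl//; exact: (nnmeas_ge0 _ nS). Qed.

(** First-step analysis: the term of index 0 is split off and the rest of the series is one taboo
    step of [S]. *)
Let S_rec x : S x = (kappa - 1)%:E + kappa%:E * K S x.
Proof.
have KS : K S x = \sum_(0 <= n <oo)
    ((kappa - 1) * kappa ^+ n)%:E * iter n.+1 K (cst 1) x.
  rewrite (il_series (il_K x)) => [|n]; last by apply: nnmeasZ => //; exact: nKn.
  by apply: eq_eseriesr => n _; rewrite (il_scale (il_K x))//; exact: nKn.
have t0 n : 0 <= ((kappa - 1) * kappa ^+ n)%:E * iter n K (cst 1) x.
  exact: (nnmeas_ge0 _ (nnmeasZ (c0 n) (nKn n nc1))).
rewrite {1}/S nneseries_recl// expr0 mulr1 mule1; congr (_ + _).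
rewrite -nneseries_addn// KS -nneseriesZl; last first.
  by move=> n _; exact: (nnmeas_ge0 _ (nnmeasZ (c0 n) (nKn n.+1 nc1))).
apply: eq_eseriesr => n _; rewrite addn1 muleA -EFinM; congr (_%:E * _).
by rewrite exprS mulrCA.
Qed.

(* E_x[kappa ^ t] for the first time t >= 0 in A. *)
Definition hitting_moment (x : X) : \bar R :=
  (\1_A x)%:E + (\1_(~` A) x)%:E * m x.
Let V := hitting_moment.

Let nV : nnmeas V.
Proof. by apply: nnmeasD => //; exact: nnmeasM. Qed.

Let kmean_split f x : nnmeas f ->
  kmean P (fun y => (\1_A y)%:E + (\1_(~` A) y)%:E * f y) x = p1 x + K f x.
Proof. by move=> nf; rewrite (il_add (il_P x))//; exact: nnmeasM. Qed.

Lemma hitting_momentA x : A x -> V x = 1.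
Proof.
by move=> Ax; rewrite /V/hitting_moment !indicE mem_set// memNset ?mul0e ?adde0//; apply.
Qed.

Lemma hitting_momentAc x : ~ A x -> V x = m x.
Proof.
by move=> Ax; rewrite /V/hitting_moment !indicE memNset// mem_set// mul1e add0e.
Qed.

Lemma hitting_moment_ge1 x : 1 <= V x.
Proof.
have [Ax|Ax] := pselect (A x); first by rewrite hitting_momentA.
by rewrite hitting_momentAc ?exit_moment_ge1.
Qed.

(** The return time is one plus the hitting time seen from the next state. Off [A], where [m = V],
    this is the drift equality for [V]; on [A] it bounds the one-step mean of [V] through [L]. *)
Lemma exit_moment_kmean x : kappa%:E * kmean P V x = m x.
Proof.
have VE : V = (fun y => 1 + (\1_(~` A) y)%:E * S y).
  apply/funext => y; have [Ay|Ay] := pselect (A y).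
    by rewrite hitting_momentA// indicE memNset ?mul0e ?adde0//; apply.
  by rewrite hitting_momentAc// indicE mem_set// mul1e.
rewrite VE (il_add (il_P x))//; last exact: nnmeasM.
rewrite {1}/kmean integral_cst// mul1e prob_kernel ge0_muleDr//; last exact: (nnmeas_ge0 _ (nK nS)).
rewrite mule1 -[kmean _ _ x]/(K S x) /m/exit_moment -[\sum_(_ <= _ <oo) _]/(S x) S_rec.
by rewrite addeA -EFinD; congr (_%:E + _); ring.
Qed.

Let Km x : kappa%:E * p1 x + kappa%:E * K m x = m x.
Proof.
rewrite -[RHS]exit_moment_kmean kmean_split// [_ * (p1 x + _)]ge0_muleDr//.
  exact: (nnmeas_ge0 _ np1).
exact: (nnmeas_ge0 _ (nK nm)).
Qed.

(* E_x[kappa ^ tau; tau even] and E_x[kappa ^ tau; tau odd] *)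
Definition even_moment (x : X) : \bar R :=
  \sum_(0 <= j <oo) (kappa ^+ (2 * j.+1))%:E * iter (2 * j).+1 K p1 x.
Definition odd_moment (x : X) : \bar R :=
  kappa%:E * p1 x + kappa%:E * K even_moment x.
Let e := even_moment.
Let o := odd_moment.

Let nt j : nnmeas (fun x => (kappa ^+ (2 * j.+1))%:E * iter (2 * j).+1 K p1 x).
Proof. by apply: nnmeasZ; [exact: exprn_ge0|exact: nKn]. Qed.
Let ne : nnmeas e. Proof. exact: nnmeas_series. Qed.
Let no : nnmeas o.
Proof. by apply: nnmeasD; apply: nnmeasZ => //; exact: nK. Qed.

Let K_odd f x : nnmeas f -> kappa%:E * K (fun y => kappa%:E * p1 y + kappa%:E * K f y) x
  = (kappa ^+ 2)%:E * K p1 x + (kappa ^+ 2)%:E * K (K f) x.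
Proof.
move=> nf; have n1' : nnmeas (fun y => kappa%:E * p1 y) by exact: nnmeasZ.
have n2' : nnmeas (fun y => kappa%:E * K f y) by apply: nnmeasZ => //; exact: nK.
rewrite (il_add (il_K x))// !(il_scale (il_K x))//; last exact: nK.
rewrite [_ * (_ * K p1 x + _)]ge0_muleDr; first by rewrite !muleA -!EFinM.
  by apply: mule_ge0 => //; exact: (nnmeas_ge0 _ (nK np1)).
by apply: mule_ge0 => //; exact: (nnmeas_ge0 _ (nK (nK nf))).
Qed.

(** An even first return happens at time 2, or else two steps avoid [A] and the return after them is
    again even. *)
Let even_momentE x : e x = (kappa ^+ 2)%:E * K p1 x + (kappa ^+ 2)%:E * K (K e) x.
Proof.
rewrite {1}/e /even_moment nneseries_recl//=; last by move=> j _; exact: (nnmeas_ge0 _ (nt j)).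
rewrite muln1; congr (_ + _).
rewrite -nneseries_addn//; last by move=> j; exact: (nnmeas_ge0 _ (nt j)).
have -> : K (K e) x = \sum_(0 <= j <oo)
    (kappa ^+ (2 * j.+1))%:E * K (K (iter (2 * j).+1 K p1)) x.
  rewrite (_ : K e = (fun y => \sum_(0 <= j <oo)
      (kappa ^+ (2 * j.+1))%:E * K (iter (2 * j).+1 K p1) y)).
    rewrite (il_series (il_K x)) => [|j].
      apply: eq_eseriesr => j _; rewrite (il_scale (il_K x))//; first exact: exprn_ge0.
      by apply: nK; exact: nKn.
    by apply: nnmeasZ; [exact: exprn_ge0|apply: nK; exact: nKn].
  apply/funext => y; rewrite (il_series (il_K y))//.
  apply: eq_eseriesr => j _; rewrite (il_scale (il_K y))//; first exact: exprn_ge0.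
  exact: nKn.
rewrite -nneseriesZl; last first.
  move=> j _; apply: mule_ge0; first by rewrite lee_fin exprn_ge0.
  exact: (nnmeas_ge0 _ (nK (nK (nKn (2 * j).+1 np1)))).
apply: eq_eseriesr => j _; rewrite muleA -EFinM -exprD addn1.
by congr ((_ ^+ _)%:E * _); [rewrite mulnS|rewrite -!iterS mulnS].
Qed.

Let odd_even x : kappa%:E * K o x = e x.
Proof. by rewrite K_odd// even_momentE. Qed.

(** The full moment [m] is a supersolution of the two-step recursion for [e] (this is [mge]), so
    induction keeps all partial sums of [e] below it. *)
Let even_le x : e x <= m x.
Proof.
have mge y : (kappa ^+ 2)%:E * K p1 y + (kappa ^+ 2)%:E * K (K m) y <= m y.
  rewrite -K_odd// -[leRHS]Km; rewrite (_ : (fun y => _) = m); last exact/funext.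
  by rewrite leeDr// mule_ge0//; exact: (nnmeas_ge0 _ np1).
pose en N y := \sum_(0 <= j < N) (kappa ^+ (2 * j.+1))%:E * iter (2 * j).+1 K p1 y.
have nen N : nnmeas (en N) by exact: nnmeas_sum.
have en_rec N y : en N.+1 y = (kappa ^+ 2)%:E * K p1 y + (kappa ^+ 2)%:E * K (K (en N)) y.
  rewrite /en big_nat_recl// muln1; congr (_ + _).
  have -> : K (en N) = (fun z => \sum_(0 <= j < N)
      (kappa ^+ (2 * j.+1))%:E * K (iter (2 * j).+1 K p1) z).
    apply/funext => z; rewrite (il_sum _ (il_K z))//.
    apply: eq_bigr => j _; rewrite (il_scale (il_K z))//; first exact: exprn_ge0.
    exact: nKn.
  rewrite (il_sum _ (il_K y)); last first.
    by move=> j; apply: nnmeasZ; [exact: exprn_ge0|apply: nK; exact: nKn].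
  rewrite ge0_sume_distrr; last first.
    by move=> j _; exact: (nnmeas_ge0 _ (nK (nnmeasZ (exprn_ge0 (2 * j.+1) k0) (nK (nKn (2 * j).+1 np1))))).
  apply: eq_bigr => j _; rewrite (il_scale (il_K y)); [|exact: exprn_ge0|]; last first.
    by apply: nK; exact: nKn.
  rewrite muleA -EFinM -exprD.
  by congr ((_ ^+ _)%:E * _); [rewrite mulnS|rewrite -!iterS mulnS].
have enm N y : en N y <= m y.
  elim: N y => [|N ih] y; first by rewrite /en big_nil; exact: (nnmeas_ge0 _ nm).
  rewrite en_rec; apply: le_trans (mge y); rewrite leeD2l// lee_wpmul2l//.
    by rewrite lee_fin exprn_ge0.
  apply: (il_le (il_K y)); [exact: nK..|] => z.
  exact: (il_le (il_K z)).
apply: lime_le; last by apply: nearW => N; exact: enm.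
by apply: is_cvg_nneseries => j _ _; exact: (nnmeas_ge0 _ (nt j)).
Qed.

Let odd_le x : o x <= m x.
Proof.
rewrite -[leRHS]Km leeD2l// lee_wpmul2l//.
exact: (il_le (il_K x)).
Qed.

(** * Two-step drift from the parity of return times *)

Section parity.
Variables L theta : R.
Hypothesis mL : forall x, A x -> m x <= L%:E.
Hypothesis etheta : forall x, A x -> e x <= theta%:E.
Hypothesis theta1 : (theta < 1)%R.
Hypothesis A0 : A !=set0.

Let L1 : (1 <= L)%R.
Proof.
case: A0 => x Ax; rewrite -lee_fin; apply: le_trans (mL Ax); exact: exit_moment_ge1.
Qed.
Let theta0 : (0 <= theta)%R.
Proof.
by case: A0 => x Ax; rewrite -lee_fin; apply: le_trans (etheta Ax); exact: (nnmeas_ge0 _ ne).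
Qed.

(** Solution of [H = L + H theta], used on [A] as a bound for the moment of the first odd visit: an
    even first return, of weight at most [theta], starts the wait afresh. *)
Let H := (L / (1 - theta))%R.
Let HE : (H = L + H * theta)%R.
Proof.
have t1 : (1 - theta != 0)%R by rewrite subr_eq0 gt_eqF.
by rewrite /H; field.
Qed.
Let H1 : (1 <= H)%R.
Proof.
have H0 : (0 <= H)%R by rewrite divr_ge0 ?subr_ge0 ?(ltW theta1)// (le_trans ler01).
by rewrite HE (le_trans L1)// lerDl mulr_ge0.
Qed.
Let Hm0 : (0 <= H - 1)%R. Proof. by rewrite subr_ge0. Qed.

(* Majorant of E_x[kappa ^ t], where t >= 0 is the first even time in A. *)
Definition even_hitting_moment (x : X) : \bar R :=
  V x + (H - 1)%:E * ((\1_(~` A) x)%:E * o x).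
Let V2 := even_hitting_moment.
(* The same for the first odd time. *)
Let W x := V x + (H - 1)%:E * ((\1_A x)%:E + (\1_(~` A) x)%:E * e x).

Lemma nnmeas_even_hitting_moment : nnmeas V2.
Proof. by apply: nnmeasD => //; apply: nnmeasZ => //; exact: nnmeasM. Qed.

Let nW : nnmeas W.
Proof.
by apply: nnmeasD => //; apply: nnmeasZ => //; apply: nnmeasD => //; exact: nnmeasM.
Qed.

Lemma even_hitting_momentA x : A x -> V2 x = 1.
Proof.
move=> Ax; rewrite /V2/even_hitting_moment hitting_momentA// indicE memNset.
  by rewrite mul0e mule0 adde0.
exact.
Qed.

Lemma le_even_hitting_moment x : V x <= V2 x.
Proof.
rewrite leeDl// mule_ge0 ?lee_fin// mule_ge0// ?lee_fin//; exact: (nnmeas_ge0 _ no).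
Qed.

Lemma even_hitting_moment_le x : V2 x <= H%:E * V x.
Proof.
have [Ax|Ax] := pselect (A x).
  by rewrite even_hitting_momentA// hitting_momentA// mule1 lee_fin.
rewrite /V2/even_hitting_moment hitting_momentAc// indicE mem_set// mul1e.
have -> : H%:E * m x = m x + (H - 1)%:E * m x.
  by rewrite -{2}[m x]mul1e -ge0_muleDl ?lee_fin// -EFinD (addrC 1%R) subrK.
by rewrite leeD2l// lee_wpmul2l// lee_fin.
Qed.

(** After one step, an even wait is an odd wait for [x]. An odd first return ends it and an even one
    costs a further factor [H], which gives [o + H e = m + (H - 1) e]. *)
Let kmeanV2 x : kappa%:E * kmean P V2 x = m x + (H - 1)%:E * e x.
Proof.
have n1o : nnmeas (fun y => (\1_(~` A) y)%:E * o y) by exact: nnmeasM.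
rewrite (il_add (il_P x))//; last exact: nnmeasZ.
rewrite [_ * (kmean P V x + _)]ge0_muleDr; first 1 last.
- exact: (nnmeas_ge0 _ (nnmeas_kmean P nV)).
- exact: (nnmeas_ge0 _ (nnmeas_kmean P (nnmeasZ Hm0 n1o))).
rewrite exit_moment_kmean; congr (_ + _).
by rewrite (il_scale (il_P x))// muleCA -[kmean _ _ x]/(K o x) odd_even.
Qed.

Let kmeanW x : kappa%:E * kmean P W x = m x + (H - 1)%:E * o x.
Proof.
have n1o : nnmeas (fun y => (\1_A y)%:E + (\1_(~` A) y)%:E * e y).
  by apply: nnmeasD => //; exact: nnmeasM.
rewrite (il_add (il_P x))//; last exact: nnmeasZ.
rewrite [_ * (kmean P V x + _)]ge0_muleDr; first 1 last.
- exact: (nnmeas_ge0 _ (nnmeas_kmean P nV)).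
- exact: (nnmeas_ge0 _ (nnmeas_kmean P (nnmeasZ Hm0 n1o))).
rewrite exit_moment_kmean; congr (_ + _).
rewrite (il_scale (il_P x))// muleCA kmean_split// [_ * (p1 x + _)]ge0_muleDr//; first exact: (nnmeas_ge0 _ np1).
exact: (nnmeas_ge0 _ (nK ne)).
Qed.

(** Equality holds off [A]; on [A] the fixed-point equation [HE] closes the estimate. *)
Let kmeanV2_le x : kappa%:E * kmean P V2 x <= W x.
Proof.
rewrite kmeanV2 /W; have [Ax|Ax] := pselect (A x).
  rewrite hitting_momentA// !indicE mem_set// memNset ?mul0e ?adde0; last exact.
  rewrite mule1 -EFinD (addrC 1%R) subrK.
  apply: (@le_trans _ _ (L%:E + (H - 1)%:E * theta%:E)).
    by rewrite leeD ?mL// lee_wpmul2l ?lee_fin// etheta.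
  by rewrite -EFinM -EFinD lee_fin {2}HE mulrBl mul1r lerD2l; rewrite gerBl.
by rewrite hitting_momentAc// !indicE memNset// mem_set// mul1e add0e.
Qed.

Let kmean2V2 x : (kappa ^+ 2)%:E * kmean P (kmean P V2) x <= m x + (H - 1)%:E * o x.
Proof.
have nV2 := nnmeas_even_hitting_moment.
rewrite -kmeanW expr2 EFinM -muleA lee_wpmul2l//.
rewrite -(il_scale (il_P x))//; last exact: nnmeas_kmean.
by apply: (il_le (il_P x)) => //; apply: nnmeasZ => //; exact: nnmeas_kmean.
Qed.

Lemma even_hitting_moment_drift x : ~ A x ->
  (kappa ^+ 2)%:E * kmean P (kmean P V2) x <= V2 x.
Proof.
move=> Ax; apply: le_trans (kmean2V2 x) _.
by rewrite /V2/even_hitting_moment hitting_momentAc// indicE mem_set// mul1e.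
Qed.

(** Both [m] and [o] are at most [L] on [A], so [m + (H - 1) o] is at most [H L]. *)
Lemma even_hitting_moment_bound x : A x ->
  (kappa ^+ 2)%:E * kmean P (kmean P V2) x <= (L ^+ 2 / (1 - theta))%:E.
Proof.
move=> Ax; apply: le_trans (kmean2V2 x) _.
apply: (@le_trans _ _ (H%:E * L%:E)); last by rewrite -EFinM lee_fin /H mulrAC -expr2.
have -> : H%:E = 1 + (H - 1)%:E :> \bar R by rewrite -EFinD (addrC 1%R) subrK.
rewrite ge0_muleDl ?lee_fin// mul1e leeD ?mL// lee_wpmul2l ?lee_fin//.
exact: le_trans (odd_le x) (mL Ax).
Qed.

End parity.
End drift.

(** * Renewal inequality for a reversible operator *)

Section renewal.
Context d (X : measurableType d) (R : realType).
Local Open Scope ring_scope.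
Variables (Q : (X -> R) -> X -> R) (nu pi : (X -> R) -> R) (A : set X) (b : R).
Hypothesis mA : measurable A.
Hypothesis bQ : forall f, bmeas f -> bmeas (Q f).
Hypothesis mQ : forall x, mean (Q ^~ x).
Hypothesis mnu : mean nu.
Hypothesis mpi : mean pi.
Hypothesis piQ : forall f, bmeas f -> pi (Q f) = pi f.
Hypothesis b0 : 0 <= b.
Hypothesis minorQ : forall f x, bmeas f -> (forall y, 0 <= f y) -> A x ->
  b * nu f <= Q f x.

Let bA : bmeas (\1_A : X -> R). Proof. exact: bmeas_indic. Qed.

(** The kernel [Q - b 1_A nu] left when the regeneration part is removed; it is positive by
    [minorQ]. *)
Definition residual (f : X -> R) (x : X) : R := Q f x - b * nu f * \1_A x.

(* Probability of no regeneration before time [n]. *)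
Definition survival n : X -> R := iter n residual (cst 1).

Let s n := nu (survival n).

Lemma bmeas_residual f : bmeas f -> bmeas (residual f).
Proof. by move=> bf; apply: bmeasB; [exact: bQ|exact: bmeasZ]. Qed.

Lemma residual_ge0 f x : bmeas f -> (forall y, 0 <= f y) -> 0 <= residual f x.
Proof.
move=> bf f0; rewrite /residual indicE; case: (boolP (x \in A)) => [/set_mem Ax|_].
  by rewrite mulr1 subr_ge0 minorQ.
by rewrite mulr0 subr0; exact: (mean_ge0 (mQ x)).
Qed.

Lemma bmeas_survival n : bmeas (survival n).
Proof. by elim: n => [|n ih]; [exact: bmeas_cst|exact: bmeas_residual]. Qed.
Let bs := bmeas_survival.

Lemma survival_ge0 n x : 0 <= survival n x.
Proof.
by elim: n x => [|n ih] x; [exact: ler01|exact: residual_ge0].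
Qed.

Let s_ge0 n : 0 <= s n.
Proof. by apply: (mean_ge0 mnu) => // x; exact: survival_ge0. Qed.

Lemma survival_le1 n x : survival n x <= 1.
Proof.
elim: n x => [|n ih] x //=; rewrite -[leRHS](mean_cst (mQ x)).
apply: (@le_trans _ _ (Q (survival n) x)).
  by rewrite gerBl// mulr_ge0// ?mulr_ge0//; exact: s_ge0.
by apply: (mean_le (mQ x)) => //; exact: bmeas_cst.
Qed.

(** As [pi] is invariant under [Q], the mass lost in one residual step is exactly the regenerating
    part. *)
Lemma mean_survival n :
  pi (survival n) = pi (survival n.+1) + b * pi \1_A * nu (survival n).
Proof.
rewrite /= (mean_sub mpi); [|exact: bQ|exact: bmeasZ].
by rewrite piQ// (mean_scale mpi)// mulrAC subrK.
Qed.

(* [renewal_sum n f = \sum_(k <= n) s k * Q ^ (n - k) f] *)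
Fixpoint renewal_sum n (f : X -> R) : X -> R :=
  if n is n'.+1 then fun x => Q (renewal_sum n' f) x + s n * f x else f.

Let bG n f : bmeas f -> bmeas (renewal_sum n f).
Proof.
by move=> bf; elim: n => //= n ih; apply: bmeasD; [exact: bQ|exact: bmeasZ].
Qed.

Let G_add n f g : bmeas f -> bmeas g ->
  renewal_sum n (fun x => f x + g x) =
  (fun x => renewal_sum n f x + renewal_sum n g x).
Proof.
move=> bf bg; elim: n => //= n ->; apply/funext => x.
rewrite (mean_add (mQ x)); [|exact: bG..].
by rewrite mulrDr addrACA.
Qed.

Let G_scale n c f : bmeas f ->
  renewal_sum n (fun x => c * f x) = (fun x => c * renewal_sum n f x).
Proof.
move=> bf; elim: n => //= n ->; apply/funext => x.
rewrite (mean_scale (mQ x)); last exact: bG.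
by rewrite mulrDr mulrCA.
Qed.

Let G_Q n f : bmeas f -> renewal_sum n (Q f) = Q (renewal_sum n f).
Proof.
move=> bf; elim: n => //= n ->; apply/funext => x.
rewrite (mean_add (mQ x)); [|by apply: bQ; exact: bG|exact: bmeasZ].
by rewrite (mean_scale (mQ x)).
Qed.

(** Decomposition at the last regeneration: the term [b s_k Q^(n - k) 1_A] is the probability of
    regenerating from [A] at time [n - k] and then surviving [k] steps. *)
Let survivalE n x : survival n.+1 x = 1 - b * renewal_sum n \1_A x.
Proof.
elim: n x => [|n ih] x.
  by rewrite /= /residual (mean_cst (mQ x)) (mean_cst mnu) mulr1.
have sE : survival n.+1 = (fun y => 1 - b * renewal_sum n \1_A y) by exact/funext.
transitivity (residual (survival n.+1) x); first by [].
rewrite /residual -/(s n.+1) [in Q _]sE.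
rewrite (mean_sub (mQ x)); [|exact: bmeas_cst|by apply: bmeasZ; exact: bG].
rewrite (mean_cst (mQ x)) (mean_scale (mQ x)); last exact: bG.
by rewrite [renewal_sum n.+1 _ _]/= mulrDr opprD addrA mulrA.
Qed.

Let renewal_identity n : b * nu (renewal_sum n \1_A) = 1 - s n.+1.
Proof.
rewrite /s (_ : survival n.+1 = (fun x => 1 - b * renewal_sum n \1_A x)).
  rewrite (mean_sub mnu); [|exact: bmeas_cst|by apply: bmeasZ; exact: bG].
  by rewrite (mean_cst mnu) (mean_scale mnu); [rewrite opprB addrC subrK|exact: bG].
by apply/funext => x; exact: survivalE.
Qed.

(** The case [n] for the residual of [f] is the case [n + 1] for [f]: by [renewal_identity] the sums
    under [nu] differ by [nu f], and the means under [pi] by [b pi(A) nu f]. *)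
Let renewal_sum_le n f : bmeas f -> (forall x, 0 <= f x) ->
  b * pi \1_A * nu (renewal_sum n f) <= pi f.
Proof.
elim: n f => [|n ih] f bf f0.
  rewrite -(piQ bf) /= mulrAC -(mean_scale mpi)//.
  apply: (mean_le mpi) => [||x]; [exact: bmeasZ|exact: bQ|].
  by rewrite -subr_ge0; exact: residual_ge0.
have bg := bmeas_residual bf.
have := ih _ bg (fun x => residual_ge0 x bf f0).
rewrite /residual (mean_sub mpi); [|exact: bQ|exact: bmeasZ].
rewrite piQ// (mean_scale mpi)//.
have -> : nu (renewal_sum n (fun x => Q f x - b * nu f * \1_A x)) =
    nu (renewal_sum n (Q f)) - nu f * (1 - s n.+1).
  rewrite -renewal_identity (_ : (fun x => _ - _) =
    (fun x => Q f x + (- (b * nu f)) * \1_A x)); last first.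
    by apply/funext => x; rewrite mulNr.
  rewrite G_add; [|exact: bQ|exact: bmeasZ].
  rewrite (mean_add mnu); [|by apply: bG; exact: bQ|by apply: bG; exact: bmeasZ].
  rewrite G_scale// (mean_scale mnu); last exact: bG.
  by rewrite mulNr [nu f * _]mulrCA mulrA.
rewrite G_Q//= (mean_add mnu); [|by apply: bQ; exact: bG|exact: bmeasZ].
rewrite (mean_scale mnu)//.
set u := nu (Q _); set p := pi \1_A; set t := s n.+1; move: (nu f) (pi f) => y z.
rewrite -subr_ge0 => H; rewrite -subr_ge0; apply: le_trans H _.
by rewrite le_eqVlt; apply/orP; left; apply/eqP; ring.
Qed.

(** The right side is the sum of [s_k (nu Q^(n - k) f - 1)] over [k <= n]. All its terms are
    nonnegative, and the one with [k = 0] is the left side because [s_0 = 1]. *)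
Let renewal_sum_ge n f : bmeas f -> (forall k, 1 <= nu (iter k Q f)) ->
  nu (iter n Q f) - 1 <= nu (renewal_sum n f) - \sum_(0 <= k < n.+1) s k.
Proof.
elim: n f => [|n ih] f bf f1.
  by rewrite big_nat1 /s /= (mean_cst mnu).
have bQf := bQ bf.
have Qf1 k : 1 <= nu (iter k Q (Q f)) by rewrite -iterSr.
have := ih _ bQf Qf1; rewrite -iterSr => /le_trans; apply.
rewrite /= G_Q// [in leRHS]big_nat_recr//= (mean_add mnu); [|by apply: bQ; exact: bG|exact: bmeasZ].
rewrite (mean_scale mnu)// opprD addrACA lerDl subr_ge0 ler_peMr//.
exact: (f1 0%N).
Qed.

Lemma renewal_bound h n : bmeas h -> (forall x, 0 <= h x) -> pi h = 1 ->
  (forall k, 1 <= nu (iter k Q h)) ->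
  b * pi \1_A * (nu (iter n Q h) - 1) <= pi (survival n.+1).
Proof.
move=> bh h0 h1 nuh.
have piA : 0 <= pi \1_A by exact: (mean_ge0 mpi).
(* Telescoping of [mean_survival], starting from [pi 1 = 1]. *)
have sumE : b * pi \1_A * \sum_(0 <= k < n.+1) s k = 1 - pi (survival n.+1).
  elim: n.+1 => [|m ih]; first by rewrite big_nil mulr0 /= (mean_cst mpi) subrr.
  by rewrite big_nat_recr// mulrDr ih (mean_survival m) opprD addrA subrK.
have := renewal_sum_le n bh h0; rewrite h1.
have := ler_wpM2l (mulr_ge0 b0 piA) (renewal_sum_ge n bh nuh).
by rewrite !mulrBr sumE; lra.
Qed.

End renewal.

(** * Self-adjointness and the variance of the iterated density *)

Section reversible_mean.
Context d (X : measurableType d) (R : realType).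
Local Open Scope ring_scope.
Variables (T : (X -> R) -> X -> R) (nu pi : (X -> R) -> R) (h : X -> R).
Hypothesis bT : forall f, bmeas f -> bmeas (T f).
Hypothesis mT : forall x, mean (T ^~ x).
Hypothesis mpi : mean pi.
Hypothesis revT : forall f g, bmeas f -> bmeas g ->
  pi (fun x => f x * T g x) = pi (fun x => g x * T f x).
Hypothesis bh : bmeas h.
Hypothesis nuE : forall f, bmeas f -> nu f = pi (fun x => h x * f x).
Hypothesis pih : pi h = 1.

Lemma mean_invariant f : bmeas f -> pi (T f) = pi f.
Proof.
move=> bf; transitivity (pi (fun x => 1 * T f x)).
  by congr pi; apply/funext => x; rewrite mul1r.
rewrite revT//; last exact: bmeas_cst.
by congr pi; apply/funext => x; rewrite (mean_cst (mT x)) mulr1.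
Qed.

Lemma bmeas_iter n f : bmeas f -> bmeas (iter n T f).
Proof. by move=> bf; elim: n => //= n; exact: bT. Qed.

Lemma mean_iter n f : bmeas f -> pi (iter n T f) = pi f.
Proof.
by move=> bf; elim: n => //= n <-; rewrite mean_invariant//; exact: bmeas_iter.
Qed.

Lemma reversible_iter n f g : bmeas f -> bmeas g ->
  pi (fun x => f x * iter n T g x) = pi (fun x => g x * iter n T f x).
Proof.
elim: n f g => [|n ih] f g bf bg.
  by congr pi; apply/funext => x; rewrite mulrC.
rewrite [LHS]revT//; last exact: bmeas_iter.
transitivity (pi (fun x => T f x * iter n T g x)).
  by congr pi; apply/funext => x; rewrite mulrC.
by rewrite ih//; [rewrite -iterSr|exact: bT].
Qed.

(** Self-adjointness moves half of the [2n] steps onto the other factor, so [nu T^(2n) h] is the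
    second moment of [T^n h]; its mean is 1, and subtracting 1 leaves the variance. *)
Lemma mean_even_iter n :
  nu (iter n (T \o T) h) - 1 = pi (fun x => (iter n T h x - 1) ^+ 2).
Proof.
have bn := bmeas_iter n bh.
have -> : iter n (T \o T) h = iter n T (iter n T h).
  by rewrite -iterD addnn; elim: n {bn} => // n ih; rewrite iterS ih doubleS.
rewrite nuE; last exact: bmeas_iter.
rewrite reversible_iter//.
have -> : (fun x => (iter n T h x - 1) ^+ 2) =
    (fun x => (iter n T h x * iter n T h x - 2 * iter n T h x) + 1).
  by apply/funext => x; ring.
rewrite (mean_add mpi); [|by apply: bmeasB; [exact: bmeasM|exact: bmeasZ]|exact: bmeas_cst].
rewrite (mean_sub mpi); [|exact: bmeasM|exact: bmeasZ].
rewrite (mean_cst mpi) (mean_scale mpi)// mean_iter// pih; ring.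
Qed.

(* AM-GM in place of the Cauchy-Schwarz inequality. *)
Lemma mean_deviation n f t : bmeas f -> (forall x, `|f x| <= 1) -> 0 < t ->
  nu (iter n (T \o T) h) - 1 <= t ^+ 2 -> `|nu (iter n T f) - pi f| <= t.
Proof.
move=> bf f1 t0; rewrite mean_even_iter => ant.
have bn := bmeas_iter n bh.
have bu : bmeas (fun x => iter n T h x - 1) by apply: bmeasB => //; exact: bmeas_cst.
set u := fun x => iter n T h x - 1.
have bound g : bmeas g -> (forall x, `|g x| <= 1) -> pi (fun x => u x * g x) <= t.
  move=> bg g1.
  have bv : bmeas (fun x => t^-1 * (u x) ^+ 2).
    by apply: bmeasZ; under eq_fun do rewrite expr2; exact: bmeasM.
  apply: (@le_trans _ _ (pi (fun x => 2^-1 * (t + t^-1 * (u x) ^+ 2)))).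
    apply: (mean_le mpi) => [||x]; first exact: bmeasM.
      by apply: bmeasZ; apply: bmeasD => //; exact: bmeas_cst.
    apply: (@le_trans _ _ `|u x|).
      by rewrite (le_trans (ler_norm _))// normrM ler_piMr.
    rewrite -(real_normK (num_real (u x))) -subr_ge0.
    have -> : 2^-1 * (t + t^-1 * `|u x| ^+ 2) - `|u x| = (2 * t)^-1 * (t - `|u x|) ^+ 2.
      by field; rewrite gt_eqF.
    by rewrite mulr_ge0// ?sqr_ge0// invr_ge0 mulr_ge0// ltW.
  rewrite (mean_scale mpi); last by apply: bmeasD => //; exact: bmeas_cst.
  rewrite (mean_add mpi)//; last exact: bmeas_cst.
  rewrite (mean_cst mpi) (mean_scale mpi); last first.
    by under eq_fun do rewrite expr2; exact: bmeasM.
  have : t^-1 * pi (fun x => u x ^+ 2) <= t.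
    by rewrite mulrC ler_pdivrMr// -expr2.
  lra.
(* The iterate is moved from [f] to the density [h]; the bound for [u] is then used with [f] and
   with [- f]. *)
have -> : nu (iter n T f) - pi f = pi (fun x => u x * f x).
  rewrite nuE; last exact: bmeas_iter.
  rewrite reversible_iter// -(mean_sub mpi)//; last by apply: bmeasM => //; exact: bmeas_iter.
  by congr pi; apply/funext => x; rewrite /u; ring.
rewrite ler_norml bound// andbT lerNl -(mean_opp mpi); last exact: bmeasM.
under eq_fun do rewrite -mulrN.
by apply: bound => [|x]; [exact: bmeasN|rewrite normrN].
Qed.

End reversible_mean.

(** * Powers of drift functions *)

Section powR_facts.
Context (R : realType).
Implicit Types s t x : R.

(** The concave power lies below its tangent at [t]. In exponential form this is [1 + y <= expR y]
    used twice with weights [1 - s] and [s], whose linear terms cancel. *)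
Lemma powR_tangent s t x : (0 <= s <= 1)%R -> (0 < t)%R -> (0 < x)%R ->
  (x `^ s <= (1 - s) * t `^ s + s * t `^ (s - 1) * x)%R.
Proof.
move=> /andP[s0 s1] t0 x0.
have [a ->] : exists a, x = expR a by exists (ln x); rewrite lnK ?posrE.
have [c ->] : exists c, t = expR c by exists (ln t); rewrite lnK ?posrE.
rewrite -!expRM -mulrA -expRD.
have -> : (c * s = a * s + s * (c - a))%R by ring.
have -> : (c * (s - 1) + a = a * s + (1 - s) * (a - c))%R by ring.
rewrite !expRD; have := expR_gt0 (a * s); set E := expR (a * s) => E0.
have h1 := expR_ge1Dx (s * (c - a)); have h2 := expR_ge1Dx ((1 - s) * (a - c)).
have -> : ((1 - s) * (E * expR (s * (c - a))) + s * (E * expR ((1 - s) * (a - c)))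
  = E * ((1 - s) * expR (s * (c - a)) + s * expR ((1 - s) * (a - c))))%R by ring.
rewrite ler_peMr ?(ltW E0)//.
have s1' : (0 <= 1 - s)%R by rewrite subr_ge0.
apply: (@le_trans _ _ ((1 - s) * (1 + s * (c - a)) + s * (1 + (1 - s) * (a - c)))%R).
  by rewrite le_eqVlt; apply/orP; left; apply/eqP; ring.
by rewrite lerD// ler_wpM2l.
Qed.

Lemma powR_subr1 s t : (0 < t)%R -> (t `^ (s - 1) * t = t `^ s)%R.
Proof.
move=> t0; rewrite -{2}(powRr1 (ltW t0)) -powRD ?subrK//.
by rewrite (gt_eqF t0) implybT.
Qed.

Lemma poweR_tangent s t (x : \bar R) : (0 < s <= 1)%R -> (0 < t)%R -> 1 <= x ->
  x `^ s <= ((1 - s) * t `^ s)%:E + (s * t `^ (s - 1))%:E * x.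
Proof.
move=> /andP[s0 s1] t0; case: x => [x| |//]; last first.
  move=> _; rewrite poweRyr ?gt_eqF// gt0_muley ?addey// lte_fin.
  by rewrite mulr_gt0// powR_gt0.
rewrite lee_fin => x1; rewrite poweR_EFin -EFinM -EFinD lee_fin.
by apply: powR_tangent => //; rewrite ?(ltW s0)// (lt_le_trans _ x1).
Qed.

End powR_facts.

(** * Jensen's inequality for a kernel with a minorizing part *)

Section jensen.
Context d (X : measurableType d) (R : realType).
Variables (T : (X -> \bar R) -> X -> \bar R) (N : (X -> \bar R) -> \bar R).
Variables (A : set X) (c : R).
Hypothesis il_T : forall x, integral_like (T ^~ x).
Hypothesis T1 : forall x, T (cst 1) x = 1.
Hypothesis il_N : integral_like N.
Hypothesis N1 : N (cst 1) = 1.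
Hypothesis c01 : (0 < c < 1)%R.
Hypothesis minor : forall f x, nnmeas f -> A x -> c%:E * N f <= T f x.
Variables (V : X -> \bar R) (lambda M s : R).
Hypothesis nV : nnmeas V.
Hypothesis V1 : forall x, 1 <= V x.
Hypothesis lambda0 : (0 < lambda)%R.
Hypothesis drift_out : forall x, ~ A x -> lambda%:E * T V x <= V x.
Hypothesis drift_in : forall x, A x -> lambda%:E * T V x <= M%:E.
Hypothesis lM : (lambda <= M)%R.
Hypothesis s01 : (0 < s <= 1)%R.
Hypothesis A0 : A !=set0.

Let v x := V x `^ s.
Let c0 : (0 < c)%R. Proof. by case/andP: c01. Qed.
Let c1 : (0 < 1 - c)%R. Proof. by rewrite subr_gt0; case/andP: c01. Qed.
Let s0 : (0 < s)%R. Proof. by case/andP: s01. Qed.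
Let s1 : (0 <= 1 - s)%R. Proof. by rewrite subr_ge0; case/andP: s01. Qed.

Lemma nnmeas_poweR : nnmeas v.
Proof.
case: nV => mV _; split=> [|x]; last exact: poweR_ge0.
exact: (measurableT_comp (measurable_poweR s) mV).
Qed.
Let nv := nnmeas_poweR.

Lemma poweR_le x : V x `^ s <= V x.
Proof.
have := poweR_tangent s01 ltr01 (V1 x).
rewrite !powR1 !mulr1; case: (V x) (V1 x) => [y| |]//; last by move=> _ _; rewrite leey.
rewrite lee_fin => y1; rewrite -EFinM -EFinD => /le_trans; apply.
have : (0 <= (1 - s) * (y - 1))%R by rewrite mulr_ge0// subr_ge0.
by rewrite lee_fin; lra.
Qed.

Lemma poweR_ge1 x : 1 <= V x `^ s.
Proof.
case: (V x) (V1 x) => [y| |]//; last by rewrite poweRyr ?gt_eqF ?leey.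
rewrite !lee_fin => y1; have := ge0_ler_powR (ltW s0) _ _ y1; rewrite powR1.
by apply; rewrite nnegrE// (le_trans _ y1).
Qed.

Let tangent t : (0 < t)%R -> nnmeas (fun x =>
    ((1 - s) * t `^ s)%:E + (s * t `^ (s - 1))%:E * V x).
Proof.
move=> t0; apply: nnmeasD; last by apply: nnmeasZ => //; rewrite mulr_ge0 ?powR_ge0// ltW.
by apply: nnmeas_cst; rewrite lee_fin mulr_ge0 ?powR_ge0.
Qed.

Let il_affine I (p q : R) : integral_like I -> I (cst 1) = 1 -> (0 <= p)%R ->
  (0 <= q)%R -> I (fun x => p%:E + q%:E * V x) = p%:E + q%:E * I V.
Proof.
move=> iI I1 p0 q0; rewrite (il_add iI); [|by apply: nnmeas_cst; rewrite lee_fin|exact: nnmeasZ].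
rewrite (il_scale iI)//; congr (_ + _).
rewrite -[RHS]mule1 -[in RHS]I1 -(il_scale iI)//.
by congr I; apply/funext => x; rewrite mule1.
Qed.

Let T_affine x (p q : R) : (0 <= p)%R -> (0 <= q)%R ->
  T (fun x => p%:E + q%:E * V x) x = p%:E + q%:E * T V x.
Proof. by move=> p0 q0; exact: (il_affine (il_T x)). Qed.

Let TV_ge1 x : 1 <= T V x.
Proof. by rewrite -(T1 x); apply: (il_le (il_T x)) => //; exact: nnmeas_cst. Qed.

(** The tangent is taken at the mean [T V x], where its average is exactly the power of the mean. *)
Lemma jensen_out x : ~ A x -> (lambda `^ s)%:E * T v x <= V x `^ s.
Proof.
move=> Ax; have := drift_out Ax.
case Vx : (V x) (V1 x) => [y| |]//; last by rewrite poweRyr ?gt_eqF ?leey.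
rewrite lee_fin => y1.
have := TV_ge1 x; case TVx : (T V x) => [t| |]//; last first.
  by rewrite gt0_muley ?lte_fin// leye_eq.
rewrite lee_fin => t1 lt; have t0 : (0 < t)%R by rewrite (lt_le_trans _ t1).
have : T v x <= (t `^ s)%:E.
  apply: (@le_trans _ _ (T (fun x => ((1 - s) * t `^ s)%:E + (s * t `^ (s - 1))%:E * V x) x)).
    apply: (il_le (il_T x)) => // [|z]; first exact: tangent.
    exact: poweR_tangent.
  rewrite T_affine ?mulr_ge0 ?powR_ge0 ?(ltW s0)// TVx -EFinM -EFinD lee_fin.
  by rewrite -mulrA powR_subr1// -mulrDl subrK mul1r.
move=> Tv; apply: (@le_trans _ _ ((lambda `^ s)%:E * (t `^ s)%:E)).
  by rewrite lee_wpmul2l// lee_fin powR_ge0.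
rewrite poweR_EFin -EFinM lee_fin -powRM ?(ltW lambda0) ?(ltW t0)//.
apply: (ge0_ler_powR (ltW s0)); rewrite ?nnegrE ?mulr_ge0 ?(ltW lambda0) ?(ltW t0)//.
by rewrite (le_trans _ y1).
Qed.

(** At any point of [A] the minorization bounds [c N V] by [T V], which the drift bound makes
    finite. *)
Lemma mean_poweR_lty : N v < +oo.
Proof.
case: A0 => x Ax; apply: (@le_lt_trans _ _ (N V)).
  by apply: (il_le il_N) => // y; exact: poweR_le.
have := minor nV Ax; have := drift_in Ax; have := TV_ge1 x.
case: (T V x) => [t| |]//; last by rewrite gt0_muley ?lte_fin.
move=> _ _; case: (N V) => [y| |]//; first by rewrite ltry.
by rewrite gt0_muley ?lte_fin.
Qed.

(** Jensen's inequality for [T - c N], a kernel of mass [1 - c] at [x], under which [V] has integral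
    at most [M / lambda - c] because [N V >= 1]. *)
Lemma jensen_in x : A x ->
  (lambda `^ s)%:E * T v x <=
  ((1 - c) `^ (1 - s) * (M - c * lambda) `^ s)%:E + (lambda `^ s * c)%:E * N v.
Proof.
move=> Ax; set D := (M - c * lambda)%R.
have D0 : (0 < D)%R.
  rewrite subr_gt0 (lt_le_trans _ lM)// gtr_pMl//; by case/andP: c01.
(* The bound on the mean of [V] under the normalized kernel [(T - c N) / (1 - c)]; the tangent there
   is optimal. *)
pose t := (D / (lambda * (1 - c)))%R.
have t0 : (0 < t)%R by rewrite divr_gt0// mulr_gt0.
have ng := tangent t0; set g := (fun x => _) in ng.
have vg y : v y <= g y by exact: poweR_tangent.
have [w nw gw] := nnmeas_complement nv ng vg.
have Ng1 : ((1 - s) * t `^ s)%:E + (s * t `^ (s - 1))%:E <= N g.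
  rewrite il_affine ?mulr_ge0 ?powR_ge0 ?(ltW s0)// leeD2l// -[leLHS]mule1.
  rewrite lee_wpmul2l ?lee_fin ?mulr_ge0 ?powR_ge0 ?(ltW s0)// -N1.
  by apply: (il_le il_N) => //; exact: nnmeas_cst.
have Tg : T g x <= ((1 - s) * t `^ s + s * t `^ (s - 1) * (M / lambda))%:E.
  rewrite T_affine ?mulr_ge0 ?powR_ge0 ?(ltW s0)// EFinD EFinM leeD2l//.
  rewrite [leRHS]EFinM lee_wpmul2l ?lee_fin ?mulr_ge0 ?powR_ge0 ?(ltW s0)//.
  by rewrite EFinM lee_pdivlMr// muleC drift_in.
have gE : g = (fun y => v y + w y) by exact/funext.
have Nv := mean_poweR_lty.
have Nvf : N v \is a fin_num.
  by rewrite ge0_fin_numE//; exact: il_ge0.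
(* Positivity of [T - c N] on [g - v = w], rearranged so that no infinite quantities are
   subtracted. *)
have key : T v x + c%:E * N g <= T g x + c%:E * N v.
  rewrite gE (il_add (il_T x))// (il_add il_N)//.
  rewrite ge0_muleDr ?(il_ge0 il_N)// -addeA leeD2l// (addeC (T w x)) leeD2l//.
  exact: minor.
move: key Ng1 Tg; rewrite -(fineK Nvf).
have : 0 <= T v x.
  apply: le_trans (_ : T (cst 1) x <= _); first by rewrite T1.
  by apply: (il_le (il_T x)) => // y; exact: poweR_ge1.
case: (T g x) => [tg| |]//; case: (T v x) => [tv| |]//; case: (N g) => [ng'| |]//;
  try by rewrite gt0_muley ?lte_fin.
rewrite -!EFinM -!EFinD !lee_fin => tv0 H1 H2 H3.
have tE : ((1 - c) `^ (1 - s) * D `^ s = lambda `^ s * ((1 - c) * t `^ s))%R.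
  have -> : (D `^ s = t `^ s * (lambda `^ s * (1 - c) `^ s))%R.
    rewrite -!powRM ?(ltW t0) ?mulr_ge0 ?(ltW lambda0) ?(ltW c1)//.
    by congr (_ `^ _)%R; rewrite /t mulfVK// gt_eqF// mulr_gt0.
  have e1 : ((1 - c) `^ (1 - s) * (1 - c) `^ s = 1 - c)%R.
    by rewrite -powRD ?subrK ?powRr1 ?(ltW c1)// (gt_eqF c1) implybT.
  by move: ((1 - c) `^ (1 - s))%R ((1 - c) `^ s)%R e1 => p q <-; ring.
rewrite tE -mulrA -mulrDr ler_wpM2l ?powR_ge0//.
have tD : (s * t `^ (s - 1) * (M / lambda - c) = s * (1 - c) * t `^ s)%R.
  have -> : (M / lambda - c = t * (1 - c))%R.
    by rewrite /t /D; field; rewrite !gt_eqF.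
  by rewrite -(powR_subr1 s t0); ring.
have := ler_wpM2l (ltW c0) H2.
move: H1 H3 tD; set ts := (t `^ s)%R; set tt := (t `^ (s - 1))%R; lra.
Qed.

End jensen.

(** * Comparison and densities *)

(** The minorization, applied to the gap between [v / r^n] and [u n], shows that [T - c N] preserves
    the bound on [A]. The error [beta / r^n] at a visit to [A] is absorbed by the slack [r beta] in
    the drift. *)
Lemma drift_comparison d (X : measurableType d) (R : realType)
    (T : (X -> \bar R) -> X -> \bar R) (N : (X -> \bar R) -> \bar R)
    (A : set X) (c r beta : R) (v : X -> \bar R) (u : nat -> X -> \bar R) :
  (forall x, integral_like (T ^~ x)) -> integral_like N -> (0 <= c)%R ->
  (forall f x, nnmeas f -> A x -> c%:E * N f <= T f x) ->
  nnmeas v -> N v < +oo -> (0 < r)%R -> (0 <= beta)%R ->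
  (forall x, ~ A x -> r%:E * T v x <= v x) ->
  (forall x, A x -> r%:E * T v x + (r * beta)%:E <= v x + (r * c)%:E * N v) ->
  (forall n, nnmeas (u n)) ->
  (forall n x, ~ A x -> u n.+1 x <= T (u n) x) ->
  (forall n x, A x -> u n.+1 x + c%:E * N (u n) <= T (u n) x + (beta / r ^+ n)%:E) ->
  (forall x, u 0%N x <= v x) ->
  forall n x, u n x <= (r ^- n)%:E * v x.
Proof.
move=> il_T il_N c0 minor nv Nv r0 beta0 vout vin nu uout uin u0.
elim=> [|n ih] x; first by rewrite expr0 invr1 mul1e.
have k0 m : (0 < r ^- m)%R by rewrite invr_gt0 exprn_gt0.
have kS : (r ^- n = r ^- n.+1 * r)%R.
  by rewrite exprS invfM mulrAC mulVf ?mul1r// gt_eqF.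
have nkv : nnmeas (fun y => (r ^- n)%:E * v y) by apply: nnmeasZ => //; exact: ltW.
have [w nw kvE] := nnmeas_complement (nu n) nkv ih.
have kv : (fun y => (r ^- n)%:E * v y) = (fun y => u n y + w y) by exact/funext.
have kT : (r ^- n)%:E * T v x = T (u n) x + T w x.
  by rewrite -(il_scale (il_T x)) ?(ltW (k0 n))// kv (il_add (il_T x)).
have [Ax|nAx] := pselect (A x); last first.
  apply: le_trans (uout n x nAx) _; apply: (@le_trans _ _ ((r ^- n)%:E * T v x)).
    by rewrite kT leeDl//; exact: (il_ge0 (il_T x)).
  rewrite kS EFinM -muleA lee_wpmul2l//; last exact: vout.
  by rewrite lee_fin ltW.
have kN : (r ^- n)%:E * N v = N (u n) + N w.
  by rewrite -(il_scale il_N) ?(ltW (k0 n))// kv (il_add il_N).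
have Nvf : N v \is a fin_num by rewrite ge0_fin_numE//; exact: il_ge0.
(* Adding a finite multiple of [N v] to both sides replaces the subtraction of the regeneration
   part. *)
rewrite -(@leeD2rE _ ((r ^- n * c)%:E * N v)); last by rewrite fin_numM.
have -> : (r ^- n * c)%:E * N v = c%:E * N (u n) + c%:E * N w.
  by rewrite mulrC EFinM -muleA kN ge0_muleDr//; exact: il_ge0.
rewrite addeA; apply: (@le_trans _ _ ((r ^- n)%:E * T v x + (beta / r ^+ n)%:E)).
  by rewrite kT [leRHS]addeAC leeD ?uin// minor.
have -> : (beta / r ^+ n)%:E = (r ^- n.+1)%:E * (r * beta)%:E.
  by rewrite -EFinM mulrA -kS mulrC.
rewrite {1}kS EFinM -muleA -ge0_muleDr; first 1 last.
- by apply: mule_ge0; [rewrite lee_fin ltW|exact: (il_ge0 (il_T x))].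
- by rewrite lee_fin mulr_ge0// ltW.
have -> : c%:E * N (u n) + c%:E * N w = (r ^- n.+1)%:E * ((r * c)%:E * N v).
  rewrite -ge0_muleDr ?(il_ge0 il_N)// -kN kS !muleA -!EFinM; congr (_%:E * _); ring.
apply: (@le_trans _ _ ((r ^- n.+1)%:E * (v x + (r * c)%:E * N v))).
  by rewrite lee_wpmul2l// ?vin// lee_fin ltW.
rewrite ge0_muleDr//; first exact: nnmeas_ge0.
by rewrite mule_ge0 ?(il_ge0 il_N)// lee_fin mulr_ge0// ltW.
Qed.

(** A chain started in the absorbing set [B] never leaves it, so irreducibility forbids positive
    mass of the complement. *)
Lemma absorbing_full d (X : measurableType d) (R : realType) dO
    (Omega : measurableType dO) (Phi : nat -> {mfun Omega >-> X})
    (Pr : X -> probability Omega R) (P : R.-pker X ~> X)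
    (pi : probability X R) (B : set X) (x : X) :
  markov_chain Phi Pr P -> irreducible Phi Pr pi -> measurable B ->
  B x -> (forall y, B y -> P y (~` B) = 0) -> pi (~` B) = 0.
Proof.
move=> hPhi hirr mB Bx PB; have mBc : measurable (~` B) by exact: measurableC.
have nB : nnmeas (fun y => (\1_(~` B) y : R)%:E) by exact: nnmeas_indic.
have le1 n y : iter n (kmean P) (fun y => (\1_(~` B) y)%:E) y <= (\1_(~` B) y)%:E.
  elim: n y => // n ih y.
  have nn : nnmeas (iter n (kmean P) (fun y => (\1_(~` B) y : R)%:E)).
    by elim: n {ih} => // n; exact: nnmeas_kmean.
  have il_y : integral_like (kmean P ^~ y) by exact: il_integral.
  apply: (le_trans (il_le il_y nn nB ih)); rewrite /kmean integral_indic// setIT.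
  have [By|nBy] := pselect (B y); first by rewrite PB// lee_fin.
  rewrite indicE mem_set//; apply: (@le_trans _ _ (P y setT)); last by rewrite prob_kernel.
  by rewrite le_measure// inE.
apply/eqP; rewrite eq_le measure_ge0 andbT leNgt; apply/negP => piB.
have [n n0] := hirr _ mBc piB x.
have -> : nstep Phi Pr n x (~` B) = \int[nstep Phi Pr n x]_y (\1_(~` B) y)%:E.
  by rewrite integral_indic// setIT.
rewrite (nstep_integral hPhi)// => /lt_le_trans/(_ (le1 n x)).
by rewrite indicE memNset ?ltxx//; apply.
Qed.

(** The Radon-Nikodym derivative is at most [C] almost everywhere; truncation at [C] makes the bound
    hold everywhere without changing integrals. *)
Lemma bounded_density d (X : measurableType d) (R : realType)
    (nu pi : probability X R) (C : R) : (0 <= C)%R ->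
  (forall B, measurable B -> nu B <= C%:E * pi B) ->
  exists2 h : X -> R, bmeas h /\ (forall x, (0 <= h x)%R) &
    forall f, nnmeas f -> \int[nu]_x f x = \int[pi]_x ((h x)%:E * f x).
Proof.
move=> C0 nupi.
have dom : nu `<< pi.
  move=> E E0 B mB BE; apply/eqP; rewrite eq_le measure_ge0 andbT.
  by apply: le_trans (nupi B mB) _; rewrite (E0 B mB BE) mule0.
have [f [f0 ffin intf fE]] := radon_nikodym_sigma_finite dom.
have mf : measurable_fun [set: X] f by exact: (measurable_int _ intf).
pose h x := Num.min (fine (f x)) C.
have mh : measurable_fun [set: X] h.
  by apply: measurable_minr => //; exact: measurableT_comp.
have h0 x : (0 <= h x)%R by rewrite /h le_min C0 fine_ge0.
exists h; first by split=> //; split=> //; exists C => x; rewrite ger0_norm// ge_min lexx orbT.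
have iL := il_integral nu measurableT.
have iR := il_weight mh h0 (il_integral pi measurableT).
move=> g ng; apply: (integral_like_eq iL iR _ ng) => B mB /=.
rewrite integral_indic// setIT; apply: etrans (fE B mB) _.
(* Only on [D] does truncation matter. There the integral of [f] is at most that of [C] by
   domination and at least that by the definition of [D]. *)
pose D := [set: X] `&` [set x | C%:E < f x].
have mD : measurable D by exact: emeasurable_fun_o_infty.
have nh : nnmeas (fun x => (h x)%:E).
  by split=> [|x]; [exact/measurable_EFinP|rewrite lee_fin].
have mfS E : measurable_fun E f by exact: measurable_funTS.
have mhS E : measurable_fun E (fun x => (h x)%:E) by apply: measurable_funTS; case: nh.
transitivity (\int[pi]_(x in B) (h x)%:E); last first.
  rewrite [LHS]integral_mkcond; apply: eq_integral => x _.
  rewrite patchE indicE; case: ifPn => _; first by rewrite mule1.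
  by rewrite mule0.
have split k : (forall x, 0 <= k x) -> measurable_fun [set: X] k ->
    \int[pi]_(x in B) k x = \int[pi]_(x in B `&` D) k x + \int[pi]_(x in B `\` D) k x.
  move=> k0 mk; rewrite -ge0_integral_setU//.
  - by rewrite setUIDK.
  - exact: measurableI.
  - exact: measurableD.
  - exact: measurable_funTS.
  - by apply/disj_setPS => x [[_ Dx] [_]]; exact.
rewrite (split _ f0 mf) (split _ _ (proj1 nh)); last by move=> x; rewrite lee_fin.
congr (_ + _); last first.
  apply: eq_integral => x /set_mem[_ nDx]; rewrite /h -[LHS]fineK//; congr _%:E.
  apply/esym/min_idPl; rewrite -lee_fin fineK// leNgt; apply/negP => Cf.
  by apply: nDx; split.
have mBD : measurable (B `&` D) by exact: measurableI.
have -> : \int[pi]_(x in B `&` D) (h x)%:E = \int[pi]_(x in B `&` D) C%:E.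
  apply: eq_integral => x /set_mem[_ [_ /= Cf]]; congr _%:E.
  by apply/min_idPr; rewrite -lee_fin fineK// ltW.
apply/eqP; rewrite eq_le; apply/andP; split.
  rewrite integral_cst//; apply: le_trans (nupi _ mBD).
  by rewrite le_eqVlt; apply/orP; left; apply/eqP/esym; exact: fE.
apply: ge0_le_integral => //.
by move=> x [_ [_ /= Cf]]; exact: ltW.
Qed.

(** * The kernel as an operator on bounded real functions *)

Section real_kernel.
Context d (X : measurableType d) (R : realType) (P : R.-pker X ~> X).
Local Open Scope ring_scope.

Definition rmean (f : X -> R) (x : X) : R := \int[P x]_y f y.

Let P1 x : (P x setT = 1)%E. Proof. exact: prob_kernel. Qed.

Lemma mean_rmean x : mean (rmean ^~ x).
Proof. exact: mean_Rintegral. Qed.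

Lemma EFin_rmean f x : bmeas f -> ((rmean f x)%:E = kmean P (EFin \o f) x)%E.
Proof. by move=> bf; exact: EFin_Rintegral. Qed.

Lemma bmeas_shift (f : X -> R) : bmeas f ->
  exists2 M : R, 0 <= M & forall x, 0 <= f x + M.
Proof.
case=> _ [M fM]; exists `|M| => // x.
have := fM x; rewrite ler_norml => /andP[+ _]; have := ler_norm M; lra.
Qed.

Lemma nnmeas_EFin (f : X -> R) : bmeas f -> (forall x, 0 <= f x) ->
  nnmeas (EFin \o f).
Proof.
by case=> mf _ f0; split=> [|x]; [exact/measurable_EFinP|rewrite lee_fin].
Qed.

Lemma bmeas_rmean f : bmeas f -> bmeas (rmean f).
Proof.
move=> bf; split.
  have [M M0 fM] := bmeas_shift bf.
  have bM : bmeas (fun x => f x + M) by apply: bmeasD => //; exact: bmeas_cst.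
  rewrite (_ : rmean f = (fun x => fine (kmean P (fun y => (f y + M)%:E) x) - M)).
    apply: measurable_funB => //; apply: measurableT_comp => //.
    by case: (nnmeas_kmean P (nnmeas_EFin bM fM)).
  apply/funext => x; rewrite -[fine _]/(rmean (fun y => f y + M) x).
  rewrite (mean_add (mean_rmean x))//; last exact: bmeas_cst.
  by rewrite (mean_cst (mean_rmean x)) addrK.
case: (bf) => _ [M fM]; exists M => x.
exact: (mean_norm_le (mean_rmean x)).
Qed.

(** Adding a large constant makes [f] nonnegative, and additivity cancels it afterwards. *)
Lemma additive_eq (I J : (X -> R) -> R) :
  (forall f g, bmeas f -> bmeas g -> I (fun x => f x + g x) = I f + I g) ->
  (forall f g, bmeas f -> bmeas g -> J (fun x => f x + g x) = J f + J g) ->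
  (forall f, bmeas f -> (forall x, 0 <= f x) -> I f = J f) ->
  forall f, bmeas f -> I f = J f.
Proof.
move=> Iadd Jadd IJ f bf; have [M M0 fM] := bmeas_shift bf.
have bM : bmeas (fun _ : X => M) by exact: bmeas_cst.
have := IJ _ (bmeasD bf bM) fM.
by rewrite Iadd// Jadd// (IJ (fun=> M))// => /addIr.
Qed.

End real_kernel.

(** Rectangles [C x B] give the identity for two indicators. It is extended to nonnegative functions
    one argument at a time, then to bounded ones by [additive_eq]. *)
Lemma reversible_rmean d (X : measurableType d) (R : realType)
    (P : R.-pker X ~> X) (pi : probability X R) : reversible P pi ->
  forall f g : X -> R, bmeas f -> bmeas g ->
  (\int[pi]_x (f x * rmean P g x) = \int[pi]_x (g x * rmean P f x))%R.
Proof.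
move=> hrev; have pi1 : pi setT = 1 by exact: probability_setT.
have il_pi := il_integral pi measurableT.
have ereal_rev (f g : X -> R) : bmeas f -> (forall x, 0 <= f x)%R ->
    bmeas g -> (forall x, 0 <= g x)%R ->
    \int[pi]_x ((f x)%:E * kmean P (EFin \o g) x) =
    \int[pi]_x ((g x)%:E * kmean P (EFin \o f) x).
  move=> bf f0 bg g0.
  have weight (k : X -> R) : bmeas k -> (forall x, 0 <= k x)%R ->
      integral_like (fun u => \int[pi]_x ((k x)%:E * u x)).
    by case=> mk _ k0; exact: il_weight.
  have weightr (k : X -> R) : bmeas k -> (forall x, 0 <= k x)%R ->
      integral_like (fun u => \int[pi]_x (u x * kmean P (EFin \o k) x)).
    move=> bk k0.
    rewrite (_ : (fun u => _) = (fun u => \int[pi]_x ((rmean P k x)%:E * u x))).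
      apply: weight; first exact: bmeas_rmean.
      by move=> x; apply: (mean_ge0 (mean_rmean P x)).
    by apply/funext => u; apply: eq_integral => x _; rewrite muleC EFin_rmean.
  have key (B : set X) : measurable B -> forall u, nnmeas u ->
      \int[pi]_x (u x * kmean P (EFin \o \1_B) x) =
      \int[pi]_x ((\1_B x)%:E * kmean P u x).
    move=> mB u nu.
    have bB : bmeas (\1_B : X -> R) by exact: bmeas_indic.
    apply: (integral_like_eq (weightr _ bB _) (il_kmean P (weight _ bB _)) _ nu) => //.
    move=> C mC /=; have := hrev (C `*` B) (measurableX mC mB).
    have -> : \int[pi]_x P x (xsection (C `*` B) x) =
        \int[pi]_x ((\1_C x)%:E * kmean P (EFin \o \1_B) x).
      apply: eq_integral => x _; rewrite /kmean /= integral_indic// setIT indicE.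
      have [xC|xC] := boolP (x \in C); first by rewrite in_xsectionX// mul1e.
      by rewrite notin_xsectionX// measure0 mul0e.
    move=> ->; apply: eq_integral => x _; rewrite /kmean integral_indic// setIT indicE.
    have [xC|xC] := boolP (x \in B); first by rewrite in_ysectionX// mul1e.
    by rewrite notin_ysectionX// measure0 mul0e.
  apply: (integral_like_eq (il_kmean P (weight _ bf f0)) (weightr _ bf f0) _ (nnmeas_EFin bg g0)).
  by move=> B mB /=; rewrite -(key B mB (EFin \o f))//; exact: nnmeas_EFin.
have real_rev (f g : X -> R) : bmeas f -> (forall x, 0 <= f x)%R ->
    bmeas g -> (forall x, 0 <= g x)%R ->
    (\int[pi]_x (f x * rmean P g x) = \int[pi]_x (g x * rmean P f x))%R.
  move=> bf f0 bg g0; rewrite /Rintegral; congr fine.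
  under eq_integral do rewrite EFinM EFin_rmean//.
  by rewrite ereal_rev//; apply: eq_integral => x _; rewrite EFinM EFin_rmean.
have mpi := mean_Rintegral pi1.
have addl (g : X -> R) : bmeas g -> forall f1 f2 : X -> R, bmeas f1 -> bmeas f2 ->
    (\int[pi]_x ((f1 x + f2 x) * rmean P g x) =
    \int[pi]_x (f1 x * rmean P g x) + \int[pi]_x (f2 x * rmean P g x))%R.
  move=> bg f1 f2 b1 b2; rewrite -(mean_add mpi); [|by apply: bmeasM => //; exact: bmeas_rmean..].
  by apply: eq_Rintegral => x _; rewrite mulrDl.
have addr (g : X -> R) : bmeas g -> forall f1 f2 : X -> R, bmeas f1 -> bmeas f2 ->
    (\int[pi]_x (g x * rmean P (fun y => f1 y + f2 y) x) =
    \int[pi]_x (g x * rmean P f1 x) + \int[pi]_x (g x * rmean P f2 x))%R.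
  move=> bg f1 f2 b1 b2; rewrite -(mean_add mpi); [|by apply: bmeasM => //; exact: bmeas_rmean..].
  by apply: eq_Rintegral => x _; rewrite (mean_add (mean_rmean P x))// mulrDr.
move=> f g bf bg.
pose I (k : X -> R) := (\int[pi]_x (k x * rmean P g x))%R.
pose J (k : X -> R) := (\int[pi]_x (g x * rmean P k x))%R.
apply: (additive_eq (I := I) (J := J)) bf => [||k bk k0]; [exact: addl|exact: addr|].
pose I' (k' : X -> R) := (\int[pi]_x (k x * rmean P k' x))%R.
pose J' (k' : X -> R) := (\int[pi]_x (k' x * rmean P k x))%R.
apply: (additive_eq (I := I') (J := J')) bg => [||k' bk' k'0]; [exact: addr|exact: addl|].
exact: real_rev.
Qed.

(** * Decay of the survival probabilities *)

(** The exponent is [s = ln Gamma / ln kappa]. The bound [Gamma <= kappa] gives [s <= 1]; the other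
    bound in the minimum is, after logarithms, the last inequality. *)
Lemma rate_exponent (R : realType) (kappa L theta b : R) :
  (1 < kappa)%R -> (0 < b < 1)%R -> (kappa ^+ 2 <= L ^+ 2 / (1 - theta))%R ->
  let Gamma := rate_Gamma kappa L theta b in
  (1 < Gamma)%R /\ exists s, [/\ (0 < s <= 1)%R, (kappa `^ s = Gamma)%R &
    ((1 - b) `^ (1 - s) * (L ^+ 2 / (1 - theta) - b * kappa ^+ 2) `^ s <= 1)%R].
Proof.
move=> k1 /andP[b0 b1] hM; rewrite /rate_Gamma /rate_gamma lt_eqF//.
set M := (L ^+ 2 / (1 - theta))%R in hM *; set D := (M - b * kappa ^+ 2)%R.
set gamma := (ln (D / (1 - b)) / ln kappa)%R; set G2 := ((1 - b) `^ _)%R.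
have k0 : (0 < kappa)%R by rewrite (lt_trans _ k1).
have lnk : (0 < ln kappa)%R by rewrite ln_gt0.
have b1' : (0 < 1 - b)%R by rewrite subr_gt0.
have D1 : ((1 - b) * kappa ^+ 2 <= D)%R by rewrite mulrBl mul1r lerB.
have k2 : (1 < kappa ^+ 2)%R by rewrite exprn_egt1.
have D0 : (0 < D)%R by rewrite (lt_le_trans _ D1)// mulr_gt0// exprn_gt0.
have lnD : (0 < ln (D / (1 - b)))%R.
  by rewrite ln_gt0// ltr_pdivlMr// mul1r (lt_le_trans _ D1)// ltr_pMr.
have gamma0 : (0 < gamma)%R by exact: divr_gt0.
have lnb : (ln (1 - b) < 0)%R by rewrite ln_lt0// b1' gtrBl.
have lnG2 : (ln G2 = - ln (1 - b) / gamma)%R by rewrite ln_powR mulrC mulrN mulNr.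
have G20 : (0 < G2)%R by rewrite powR_gt0.
have G21 : (1 < G2)%R.
  by rewrite -ltr_ln ?posrE// ln1 lnG2 divr_gt0// oppr_gt0.
have G1 : (1 < Num.min kappa G2)%R by rewrite lt_min k1.
set G := Num.min kappa G2 in G1 *; have G0 : (0 < G)%R by rewrite (lt_trans _ G1).
split=> //; exists (ln G / ln kappa)%R; set s := (ln G / ln kappa)%R.
have sk : (s * ln kappa = ln G)%R by rewrite /s mulfVK// gt_eqF.
have sG2 : (s * ln (D / (1 - b)) <= - ln (1 - b))%R.
  have -> : (ln (D / (1 - b)) = gamma * ln kappa)%R by rewrite /gamma mulfVK// gt_eqF.
  rewrite mulrCA sk mulrC -ler_pdivlMr// -lnG2 ler_ln ?posrE//.
  by rewrite /G ge_min lexx orbT.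
split.
- rewrite divr_gt0 ?ln_gt0//= ler_pdivrMr// mul1r ler_ln ?posrE//.
  by rewrite /G ge_min lexx.
- by rewrite /powR gt_eqF// sk lnK.
- rewrite -ler_ln ?posrE ?mulr_gt0 ?powR_gt0// ln1 lnM ?posrE ?powR_gt0// !ln_powR.
  move: sG2; rewrite ln_div ?posrE//; lra.
Qed.

(** * Consequences of the minorization condition *)

Section minorization.
Context d (X : measurableType d) (R : realType) (P : R.-pker X ~> X).
Variables (A : set X) (delta : R) (nu : probability X R).
Hypothesis mA : measurable A.
Hypothesis delta0 : (0 < delta)%R.
Hypothesis hminor : forall x B, measurable B -> (delta * \1_A x)%:E * nu B <= P x B.

Let il_nu : integral_like (fun f => \int[nu]_x f x).
Proof. exact: il_integral. Qed.

Lemma minor_kmean f x : nnmeas f -> A x -> delta%:E * \int[nu]_y f y <= kmean P f x.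
Proof.
move=> nf Ax; rewrite -(il_scale il_nu)//; last exact: ltW.
have iL : integral_like (fun f => \int[nu]_y (delta%:E * f y)).
  by apply: (il_weight (g := cst delta)) => // y; exact: ltW.
have iR : integral_like (kmean P ^~ x) by exact: il_integral.
apply: (integral_like_le iL iR) nf => B mB /=.
rewrite (il_scale il_nu); [|exact: ltW|exact: nnmeas_indic].
have := hminor x mB; rewrite indicE mem_set// mulr1.
by rewrite /kmean !integral_indic// !setIT.
Qed.

(** From [A] the first step regenerates with weight [delta]; the new state is in [A] with
    probability [nu A], and the second step regenerates again. *)
Lemma minor_kmean2 f x : nnmeas f -> A x ->
  (delta ^+ 2 * fine (nu A))%:E * \int[nu]_y f y <= kmean P (kmean P f) x.
Proof.
move=> nf Ax; have nPf := nnmeas_kmean P nf.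
apply: le_trans (minor_kmean nPf Ax).
have Nf0 : 0 <= \int[nu]_y f y by exact: (il_ge0 il_nu).
have dN0 : 0 <= delta%:E * \int[nu]_y f y by rewrite mule_ge0// lee_fin ltW.
rewrite expr2 -mulrA EFinM -muleA lee_wpmul2l//; first by rewrite lee_fin ltW.
rewrite mulrC EFinM -muleA fineK ?fin_num_measure//.
have n1 : nnmeas (fun x : X => (\1_A x : R)%:E) by exact: nnmeas_indic.
have -> : nu A * (delta%:E * \int[nu]_y f y) =
    \int[nu]_x ((delta%:E * \int[nu]_y f y) * (\1_A x)%:E).
  rewrite ge0_integralZl//; last by case: n1.
  by rewrite integral_indic// setIT muleC.
apply: (il_le il_nu) => // [|y]; first by apply: nnmeasM => //; exact: nnmeas_cst.
rewrite indicE; case: (boolP (y \in A)) => [/set_mem Ay|_].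
  by rewrite mule1; exact: minor_kmean.
by rewrite mule0; exact: nnmeas_ge0.
Qed.

(** Integrate the minorization against the invariant measure. *)
Lemma minor_le_invariant (pi : probability X R) : invariant_probability P pi ->
  0 < pi A -> forall B, measurable B -> nu B <= ((delta * fine (pi A))^-1)%:E * pi B.
Proof.
move=> hpi hA B mB.
have piA : pi A = (fine (pi A))%:E by rewrite fineK// fin_num_measure.
have a0 : (0 < fine (pi A))%R by rewrite -lte_fin -piA.
have da0 : (0 < delta * fine (pi A))%R by rewrite mulr_gt0.
rewrite muleC lee_pdivlMr// -(hpi B mB) EFinM -piA.
have -> : nu B * (delta%:E * pi A) = \int[pi]_x ((delta%:E * nu B) * (\1_A x)%:E).
  rewrite ge0_integralZl//.
  - by rewrite integral_indic// setIT muleCA muleA.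
  - exact/measurable_EFinP.
  - by rewrite mule_ge0// lee_fin ltW.
apply: ge0_le_integral => //.
- by move=> x _; rewrite mule_ge0// mule_ge0// lee_fin ltW.
- by apply: emeasurable_funM => //; exact/measurable_EFinP.
- exact: measurable_kernel.
- by move=> x _; rewrite muleAC -EFinM; exact: hminor.
Qed.

End minorization.

Section survival_decay.
Context d (X : measurableType d) (R : realType) (P : R.-pker X ~> X).
Variables (A : set X) (b : R) (nu pi : probability X R).
Hypothesis mA : measurable A.
Hypothesis b0 : (0 <= b)%R.

Let T := rmean P.
Let Q := T \o T.
Let Enu (f : X -> R) := (\int[nu]_x f x)%R.
Let Epi (f : X -> R) := (\int[pi]_x f x)%R.
Let mnu : mean Enu. Proof. by apply: mean_Rintegral; exact: probability_setT. Qed.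
Let mpi : mean Epi. Proof. by apply: mean_Rintegral; exact: probability_setT. Qed.
Let EnuE f : bmeas f -> (Enu f)%:E = \int[nu]_x (f x)%:E.
Proof. by move=> bf; apply: EFin_Rintegral => //; exact: probability_setT. Qed.
Let Q2 (f : X -> \bar R) := kmean P (kmean P f).
Let il_Q2 x : integral_like (Q2 ^~ x).
Proof. by apply: (il_kmean P (I := kmean P ^~ x)); exact: il_integral. Qed.
Let il_nu : integral_like (fun f => \int[nu]_x f x).
Proof. exact: il_integral. Qed.

Lemma EFin_rmean2 f x : bmeas f -> (Q f x)%:E = Q2 (EFin \o f) x.
Proof.
move=> bf; rewrite /Q /= EFin_rmean; last exact: bmeas_rmean.
by congr (kmean P _ x); apply/funext => y /=; rewrite EFin_rmean.
Qed.

Lemma bmeas_rmean2 f : bmeas f -> bmeas (Q f).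
Proof. by move=> bf; do 2 apply: bmeas_rmean. Qed.

Lemma mean_rmean2 x : mean (Q ^~ x).
Proof.
apply: (mean_comp (I := T ^~ x) (J := T)); first exact: mean_rmean.
- exact: bmeas_rmean.
- exact: mean_rmean.
Qed.

Hypothesis piQ : forall f, bmeas f -> Epi (Q f) = Epi f.
Hypothesis minor : forall f x, nnmeas f -> A x ->
  b%:E * \int[nu]_y f y <= Q2 f x.

Lemma minor_rmean2 f x : bmeas f -> (forall y, 0 <= f y)%R -> A x ->
  (b * Enu f <= Q f x)%R.
Proof.
move=> bf f0 Ax; rewrite -lee_fin EFinM EnuE// EFin_rmean2//.
by apply: minor => //; exact: nnmeas_EFin.
Qed.

Let rho := survival Q Enu A b.
Let brho n : bmeas (rho n).
Proof. exact: bmeas_survival mA bmeas_rmean2 n. Qed.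
Let rho0 n x : (0 <= rho n x)%R.
Proof. exact: survival_ge0 mA bmeas_rmean2 mean_rmean2 minor_rmean2 n x. Qed.
Let rho1 n x : (rho n x <= 1)%R.
Proof. exact: survival_le1 mA bmeas_rmean2 mean_rmean2 mnu b0 minor_rmean2 n x. Qed.

Variables (v : X -> \bar R) (r : R).
Hypothesis nv : nnmeas v.
Hypothesis v1 : forall x, 1 <= v x.
Hypothesis Nv : \int[nu]_x v x < +oo.
Hypothesis r1 : (1 < r)%R.
Hypothesis vout : forall x, ~ A x -> r%:E * Q2 v x <= v x.
Hypothesis vin : forall x, A x -> r%:E * Q2 v x <= v x + (r * b)%:E * \int[nu]_y v y.
Hypothesis vfin : pi [set x | v x = +oo] = 0.

Let r0 : (0 < r)%R. Proof. by rewrite (lt_trans _ r1). Qed.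

Let rho_le n x : (rho n x)%:E <= (r ^- n)%:E * v x.
Proof.
have rhoS m y : rho m.+1 y = (Q (rho m) y - b * Enu (rho m) * \1_A y)%R by [].
apply: (drift_comparison il_Q2 il_nu b0 minor nv Nv r0 (lexx 0%R) vout
  (u := fun n x => (rho n x)%:E)).
- by move=> y Ay; rewrite mulr0 adde0; exact: vin.
- by move=> m; exact: nnmeas_EFin.
- by move=> m y nAy; rewrite -[leRHS]EFin_rmean2// rhoS indicE memNset// mulr0 subr0.
- move=> m y Ay; rewrite mul0r adde0 -[X in _ <= X]EFin_rmean2// -EnuE// -EFinM -EFinD.
  by rewrite rhoS indicE mem_set// mulr1 subrK.
- by move=> y; exact: v1.
Qed.

(** Dominated convergence; pointwise decay comes from [rho_le] wherever [v] is finite. *)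
Let rho_cvg : Epi (rho n) @[n --> \oo] --> (0 : R)%R.
Proof.
have mv : measurable [set x | v x = +oo].
  rewrite (_ : [set _ | _] = [set: X] `&` v @^-1` [set +oo]); last by rewrite setTI.
  by case: nv => mv _; exact: mv.
have [|||||_ _] := @dominated_convergence _ _ _ pi setT measurableT
  (fun n x => (rho n x)%:E) (cst 0) (cst 1).
- by move=> n; apply/measurable_EFinP; case: (brho n).
- by [].
- exists [set x | v x = +oo]; split=> // x /=; apply: contra_notP => vx _.
  have [y vy] : exists y : R, v x = y%:E.
    by exists (fine (v x)); rewrite fineK// ge0_fin_numE ?ltey//;
      [exact/eqP|exact: nnmeas_ge0].
  apply/cvg_EFin; first exact: nearW.
  apply: (@squeeze_cvgr _ _ _ _ (cst 0%R) (geometric y r^-1)); last 2 first.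
  + exact: cvg_cst.
  + by apply: cvg_geometric; rewrite gtr0_norm ?invr_gt0// invf_lt1.
  apply: nearW => n /=; rewrite rho0/= mulrC exprVn -lee_fin EFinM -vy.
  exact: rho_le.
- exact: finite_measure_integrable_cst.
- apply: aeW => x n _ /=; rewrite lee_fin ger0_norm; first exact: rho1.
  exact: rho0.
rewrite /= integral0 => h.
rewrite (_ : (fun n => Epi (rho n)) = fine \o (fun n => \int[pi]_x (rho n x)%:E)).
  exact: fine_cvg h.
by [].
Qed.

(** Finiteness is known for the mean of [v] under [nu], not under [pi]. Hence the mean under [pi] is
    written as the sum of its later losses, each controlled under [nu] by [mean_survival]. *)
Lemma survival_decay : exists2 C : R, (0 <= C)%R &
  forall n, (Epi (rho n) <= C * r ^- n)%R.
Proof.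
have piA0 : (0 <= Epi \1_A)%R by apply: (mean_ge0 mpi) => //; exact: bmeas_indic.
set c2 := fine (\int[nu]_x v x).
have c2E : \int[nu]_x v x = c2%:E by rewrite fineK// ge0_fin_numE//; exact: il_ge0.
have c20 : (0 <= c2)%R by rewrite -lee_fin -c2E; exact: il_ge0.
have sle n : (Enu (rho n) <= c2 * r ^- n)%R.
  rewrite -lee_fin EnuE// mulrC EFinM -c2E -(il_scale il_nu)//; last first.
    by rewrite invr_ge0 exprn_ge0// ltW.
  apply: (il_le il_nu) => //; first exact: nnmeas_EFin.
  by apply: nnmeasZ => //; rewrite invr_ge0 exprn_ge0// ltW.
pose C0 := (b * Epi \1_A * c2)%R.
have C00 : (0 <= C0)%R by rewrite !mulr_ge0.
have rm1 : (0 < r - 1)%R by rewrite subr_gt0.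
(* The factor [r / (r - 1)] is the sum of the geometric tail; [m] tends to infinity below. *)
have step m n : (Epi (rho n) <= Epi (rho (n + m)) + C0 * r / (r - 1) * r ^- n)%R.
  elim: m n => [|m ih] n.
    rewrite addn0 lerDl; apply: mulr_ge0; last by rewrite invr_ge0 exprn_ge0// ltW.
    by rewrite divr_ge0 ?mulr_ge0// ltW.
  rewrite (mean_survival Enu b mA bmeas_rmean2 mpi piQ).
  have H1 := ih n.+1.
  have H2 : (b * Epi \1_A * Enu (rho n) <= C0 * r ^- n)%R.
    by rewrite -[leRHS]mulrA ler_wpM2l// mulr_ge0.
  apply: le_trans (lerD H1 H2) _; rewrite addSnnS -addrA lerD2l.
  rewrite le_eqVlt; apply/orP; left; apply/eqP; rewrite exprS.
  by field; rewrite !gt_eqF ?exprn_gt0.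
exists (C0 * r / (r - 1))%R; first by rewrite divr_ge0 ?mulr_ge0// ltW.
move=> n; rewrite -[leRHS]add0r.
have h : (Epi (rho (n + m)) + C0 * r / (r - 1) * r ^- n)%R @[m --> \oo] -->
    (0 + C0 * r / (r - 1) * r ^- n : R)%R.
  apply: cvgD; last exact: cvg_cst.
  under eq_fun do rewrite addnC.
  by apply: cvg_comp rho_cvg; exact: cvg_addnr.
apply: (cvgr_to_ge h); apply: nearW => m; exact: step.
Qed.

End survival_decay.

(** * Convergence rate *)

Section main_case.
Context d (X : measurableType d) (R : realType) dO (Omega : measurableType dO).
Variables (Phi : nat -> {mfun Omega >-> X}) (Pr : X -> probability Omega R).
Variables (P : R.-pker X ~> X) (pi nu : probability X R) (A : set X).
Variables (kappa delta L theta : R).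
Hypothesis hPhi : markov_chain Phi Pr P.
Hypothesis hpi : invariant_probability P pi.
Hypothesis hirr : irreducible Phi Pr pi.
Hypothesis hrev : reversible P pi.
Hypothesis mA : measurable A.
Hypothesis hA : 0 < pi A.
Hypothesis kappa1 : (1 < kappa)%R.
Hypothesis delta0 : (0 < delta)%R.
Hypothesis hminor : forall x B, measurable B -> (delta * \1_A x)%:E * nu B <= P x B.
Hypothesis mL : forall x, A x -> exit_moment P A kappa x <= L%:E.
Hypothesis meven : forall x, A x -> even_moment P A kappa x <= theta%:E.
Hypothesis theta1 : (theta < 1)%R.

Let V := hitting_moment P A kappa.
Let nV : nnmeas V.
Proof.
apply: nnmeasD; first exact: nnmeas_indic.
apply: nnmeasM; last exact: nnmeas_exit_moment.
by apply: nnmeas_indic; exact: measurableC.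
Qed.
Let V1 x : 1 <= V x. Proof. exact: hitting_moment_ge1. Qed.
Let k0 : (0 < kappa)%R. Proof. by rewrite (lt_trans _ kappa1). Qed.
Let il_P x : integral_like (kmean P ^~ x). Proof. exact: il_integral. Qed.
Let il_nu : integral_like (fun f => \int[nu]_x f x). Proof. exact: il_integral. Qed.
Let kmean1 x : kmean P (cst 1) x = 1.
Proof. by rewrite /kmean integral_cst// mul1e prob_kernel. Qed.
Let nu1 : \int[nu]_x cst 1 x = 1.
Proof. by rewrite integral_cst// mul1e; exact: probability_setT. Qed.

Let A0 : A !=set0.
Proof. by apply/set0P/eqP => A00; move: hA; rewrite A00 measure0 ltxx. Qed.

(** The set where [V] is finite contains [A] and is absorbing, since [V] finite at [y] forces a
    finite one-step mean of [V] there. *)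
Lemma hitting_moment_ae : pi [set x | V x = +oo] = 0.
Proof.
have [mV _] := nV; have [x0 Ax0] := A0.
have mB : measurable (~` [set x | V x = +oo]).
  apply: measurableC; rewrite (_ : [set _ | _] = [set: X] `&` V @^-1` [set +oo]).
    exact: mV.
  by rewrite setTI.
rewrite -[[set x | _]]setCK; apply: (absorbing_full (x := x0) hPhi hirr mB).
  by rewrite /= /V hitting_momentA.
move=> y /= Vy; rewrite setCK.
have mBc : measurable [set x | V x = +oo] by rewrite -[[set x | _]]setCK; exact: measurableC.
have PV : kmean P V y < +oo.
  have : kappa%:E * kmean P V y < +oo.
    rewrite exit_moment_kmean//; have [Ay|nAy] := pselect (A y).
      exact: le_lt_trans (mL Ay) (ltry _).
    by rewrite -hitting_momentAc// ltey; exact/eqP.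
  have /= := il_ge0 (il_P y) nV; case: (kmean P V y) => [z| |]//.
    by move=> _ _; rewrite ltry.
  by move=> _; rewrite gt0_muley ?lte_fin.
set S := [set x | V x = +oo] in mBc *.
have : +oo * P y S <= kmean P V y.
  have -> : +oo * P y S =
      \int[P y]_x (+oo * (\1_S x)%:E).
    rewrite ge0_integralZl//; first by rewrite integral_indic// setIT.
    by case: (nnmeas_indic R mBc).
  apply: (il_le (il_P y)) => // [|z].
    by apply: nnmeasM; [exact: nnmeas_cst|exact: nnmeas_indic].
  rewrite indicE; case: (boolP (z \in _)) => [/set_mem /= ->|_]; first exact: leey.
  by rewrite mule0 nnmeas_ge0.
move=> /le_lt_trans/(_ PV); have := measure_ge0 (P y) S.
rewrite le_eqVlt => /predU1P[<-//|p0].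
by rewrite gt0_mulye.
Qed.

Let b := (delta ^+ 2 * fine (nu A))%R.
Hypothesis b01 : (0 < b < 1)%R.
Let b0 : (0 < b)%R. Proof. by case/andP: b01. Qed.
Let Gamma := rate_Gamma kappa L theta b.
Let T := rmean P.
Let Enu (f : X -> R) := (\int[nu]_x f x)%R.
Let Epi (f : X -> R) := (\int[pi]_x f x)%R.
Let mnu : mean Enu. Proof. by apply: mean_Rintegral; exact: probability_setT. Qed.
Let mpi : mean Epi. Proof. by apply: mean_Rintegral; exact: probability_setT. Qed.

Let EnuE f : bmeas f -> (Enu f)%:E = \int[nu]_x (f x)%:E.
Proof. by move=> bf; apply: EFin_Rintegral => //; exact: probability_setT. Qed.

Let kL : (kappa <= L)%R.
Proof.
have [x Ax] := A0; rewrite -lee_fin; apply: le_trans (mL Ax).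
rewrite -exit_moment_kmean// -[leLHS]mule1 lee_wpmul2l ?lee_fin ?(ltW k0)//.
by rewrite -(kmean1 x); apply: (il_le (il_P x)) => //; exact: nnmeas_cst.
Qed.

Let theta0 : (0 <= theta)%R.
Proof.
have [x Ax] := A0; rewrite -lee_fin; apply: le_trans (meven Ax).
apply: nneseries_ge0 => j _ _; apply: mule_ge0; first by rewrite lee_fin exprn_ge0// ltW.
by apply/nnmeas_ge0/nnmeas_iter_taboo => //; apply: nnmeas_kmean; exact: nnmeas_indic.
Qed.

Let kM : (L ^+ 2 <= L ^+ 2 / (1 - theta))%R.
Proof.
rewrite ler_pdivlMr ?subr_gt0// ler_piMr ?sqr_ge0//; by rewrite gerBl.
Qed.

Let k2M : (kappa ^+ 2 <= L ^+ 2 / (1 - theta))%R.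
Proof.
by apply: le_trans kM; rewrite lerXn2r// nnegrE ?(ltW k0)// (le_trans (ltW k0)).
Qed.

Let Gamma1 : (1 < Gamma)%R.
Proof. by case: (rate_exponent kappa1 b01 k2M). Qed.

Let revT f g : bmeas f -> bmeas g ->
  Epi (fun x => f x * T g x)%R = Epi (fun x => g x * T f x)%R.
Proof. exact: reversible_rmean. Qed.

(** Two-step drift gives survival decay at rate [Gamma^2], the renewal bound carries it to the
    variance of [T^n h], and the deviation under [nu] is at most the square root of that order. *)
Lemma start_decay : exists2 C : R, (0 < C)%R & forall (f : X -> R) n,
  bmeas f -> (forall x, `|f x| <= 1)%R ->
  (`|Enu (iter n T f) - Epi f| <= C * Gamma ^- n)%R.
Proof.
have [_ [s [s01 ks q2]]] := rate_exponent kappa1 b01 k2M.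
have [s0 _] := andP s01.
pose V2 := even_hitting_moment P A kappa L theta.
pose v2 x := V2 x `^ s.
pose Q2 (f : X -> \bar R) := kmean P (kmean P f).
have il_Q2 x : integral_like (Q2 ^~ x) by exact: (il_kmean P (I := kmean P ^~ x)).
have Q21 x : Q2 (cst 1) x = 1.
  by rewrite /Q2 (_ : kmean P (cst 1) = cst 1) ?kmean1//; exact/funext.
have nV2 : nnmeas V2 by exact: nnmeas_even_hitting_moment mL meven theta1 A0.
have V21 x : 1 <= V2 x by apply: le_trans (V1 x) _; exact: le_even_hitting_moment.
have V2A x : A x -> V2 x = 1 by exact: even_hitting_momentA.
have minor f x : nnmeas f -> A x -> b%:E * \int[nu]_y f y <= Q2 f x.
  exact: minor_kmean2.
have k20 : (0 < kappa ^+ 2)%R by rewrite exprn_gt0.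
have vout := jensen_out il_Q2 Q21 nV2 V21 k20
  (even_hitting_moment_drift mA kappa1 mL meven theta1 A0) s01.
have vin := jensen_in il_Q2 Q21 il_nu nu1 b01 minor nV2 V21 k20
  (even_hitting_moment_bound mA kappa1 mL meven theta1 A0) k2M s01 A0.
have Nv := mean_poweR_lty il_Q2 Q21 il_nu b01 minor nV2 V21 k20
  (even_hitting_moment_bound mA kappa1 mL meven theta1 A0) s01 A0.
have rE : ((kappa ^+ 2) `^ s = Gamma ^+ 2)%R.
  by rewrite expr2 powRM ?(ltW k0)// ks -expr2.
have r1 : (1 < Gamma ^+ 2)%R by rewrite exprn_egt1.
have piQ f : bmeas f -> Epi ((T \o T) f) = Epi f.
  move=> bf; exact: (mean_iter (bmeas_rmean P) (mean_rmean P) revT 2 bf).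
have vfin : pi [set x | v2 x = +oo] = 0.
  have mS (g : X -> \bar R) : nnmeas g -> measurable [set x | g x = +oo].
    case=> mg _; rewrite (_ : [set _ | _] = [set: X] `&` g @^-1` [set +oo]); first exact: mg.
    by rewrite setTI.
  apply/eqP; rewrite eq_le measure_ge0 andbT -[leRHS]hitting_moment_ae.
  apply: le_measure; rewrite ?inE; [by apply: mS; exact: nnmeas_poweR|exact: mS|].
  (* Since [V2 <= H V] with [H] finite, [V] is infinite wherever [V2] is. *)
  move=> x /= /poweR_eqy V2y.
  have := even_hitting_moment_le mA kappa1 mL meven theta1 A0 x.
  rewrite -/V -/V2 V2y leye_eq; by case: (V x) (V1 x).
have vin' x : A x -> (Gamma ^+ 2)%:E * Q2 v2 x <=
    v2 x + (Gamma ^+ 2 * b)%:E * \int[nu]_y v2 y.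
  (* The constant in Jensen's bound is at most 1 by the choice of [s], and [v2 = 1] on [A]. *)
  move=> Ax; have := vin x Ax; rewrite rE => /le_trans; apply.
  by rewrite leeD2r// /v2 V2A// poweR_EFin powR1 lee_fin.
have vout' x : ~ A x -> (Gamma ^+ 2)%:E * Q2 v2 x <= v2 x.
  by move=> nAx; have := vout x nAx; rewrite rE.
have [C1 C10 rhoC] := survival_decay mA (ltW b0) piQ minor (nnmeas_poweR s nV2)
  (poweR_ge1 V21 s01) Nv r1 vout' vin' vfin.
have piAE : pi A = (Epi \1_A)%:E.
  rewrite /Epi EFin_Rintegral; [|exact: probability_setT|exact: bmeas_indic].
  by rewrite integral_indic// setIT.
have piA0 : (0 < Epi \1_A)%R by rewrite -lte_fin -piAE.
have c0 : (0 <= (delta * fine (pi A))^-1)%R.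
  by rewrite invr_ge0 mulr_ge0 ?(ltW delta0)// piAE ltW.
have [h [bh h0] hE] :=
  bounded_density c0 (minor_le_invariant mA delta0 hminor hpi hA).
have nuE f : bmeas f -> Enu f = Epi (fun x => h x * f x)%R.
  apply: (additive_eq (J := fun f => Epi (fun x => h x * f x)%R)).
  - by move=> f1 f2 b1 b2; exact: (mean_add mnu).
  - move=> f1 f2 b1 b2; rewrite -(mean_add mpi); [|exact: bmeasM..].
    by congr Epi; apply/funext => x; rewrite mulrDr.
  - by move=> k bk kk0; rewrite /Enu /Epi /Rintegral hE//; exact: nnmeas_EFin.
have pih : Epi h = 1%R.
  rewrite -[RHS](mean_cst mnu) nuE; last exact: bmeas_cst.
  by congr Epi; apply/funext => x; rewrite mulr1.
have a0 k : (1 <= Enu (iter k (T \o T) h))%R.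
  rewrite -subr_ge0 (mean_even_iter (bmeas_rmean P) (mean_rmean P) mpi revT bh nuE pih).
  apply: (mean_ge0 mpi) => [|x]; last exact: sqr_ge0.
  have bk : bmeas (fun x => iter k T h x - 1)%R.
    by apply: bmeasB; [exact: (bmeas_iter (bmeas_rmean P))|exact: bmeas_cst].
  by under eq_fun do rewrite expr2; exact: bmeasM.
have bpi0 : (0 < b * Epi \1_A)%R by rewrite mulr_gt0.
pose C2 := (C1 / (b * Epi \1_A))%R.
have C20 : (0 <= C2)%R by rewrite divr_ge0// ltW.
have G0 : (0 < Gamma)%R by rewrite (lt_trans _ Gamma1).
have an n : (Enu (iter n (T \o T) h) - 1 <= C2 * (Gamma ^- n) ^+ 2)%R.
  have := renewal_bound mA (bmeas_rmean2 P) (mean_rmean2 P) mnu mpi piQ (ltW b0)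
    (minor_rmean2 minor) n bh h0 pih a0.
  move=> /le_trans/(_ (rhoC n.+1)); rewrite mulrC -ler_pdivlMr// => /le_trans; apply.
  rewrite /C2 [leRHS]mulrAC ler_wpM2r ?invr_ge0 ?(ltW bpi0)// ler_wpM2l//.
  rewrite exprVn -!exprM lef_pV2 ?posrE ?exprn_gt0//.
  by apply: ler_weXn2l; [exact: ltW|rewrite mulnC leq_mul2l leqnSn orbT].
(* The square of [1 + C2] dominates [C2], and the constant stays positive even when [C2 = 0]. *)
exists (1 + C2)%R; first by rewrite ltr_pwDl.
move=> f n bf f1.
apply: (mean_deviation (bmeas_rmean P) (mean_rmean P) mpi revT bh nuE pih bf f1).
  by rewrite mulr_gt0 ?invr_gt0 ?exprn_gt0// ltr_pwDl.
apply: le_trans (an n) _; rewrite exprMn ler_wpM2r ?sqr_ge0//.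
by rewrite expr2; nra.
Qed.

(** The deviations [|T^n f - pi f|] satisfy the one-step drift comparison up to the error
    [c |nu T^n f - pi f|] at visits to [A], which [start_decay] bounds. *)
Lemma pointwise_decay x : V x < +oo -> exists C : R, forall (f : X -> R) n,
  bmeas f -> (forall y, `|f y| <= 1)%R ->
  (`|iter n T f x - Epi f| <= C * Gamma ^- n)%R.
Proof.
have [_ [s [s01 ks q2]]] := rate_exponent kappa1 b01 k2M.
have [C0 C00 hC0] := start_decay.
have [s0 s1] := andP s01; have [_ b1] := andP b01.
have L0 : (0 < L)%R by rewrite (lt_le_trans k0).
(* With [c = sqrt b <= delta] the one-step minorization persists, and [1 - b] and [L^2 - b kappa^2]
   factor as differences of squares. *)
have [c [c0 cb]] : exists c : R, (0 < c)%R /\ (c ^+ 2 = b)%R.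
  by exists (Num.sqrt b); rewrite sqrtr_gt0 sqr_sqrtr// ltW.
have c1 : (c < 1)%R by rewrite -(ltr_pXn2r (n := 2)) ?nnegrE ?(ltW c0)// cb expr1n.
have c01 : (0 < c < 1)%R by rewrite c0.
have cdelta : (c <= delta)%R.
  rewrite -(ler_pXn2r (n := 2)) ?nnegrE ?(ltW c0) ?(ltW delta0)// cb /b.
  rewrite ler_piMr ?sqr_ge0// -lee_fin fineK ?fin_num_measure//; exact: probability_le1.
pose q1 := ((1 - c) `^ (1 - s) * (L - c * kappa) `^ s)%R.
have Lck : (0 < L - c * kappa)%R.
  by rewrite subr_gt0 (lt_le_trans _ kL)// gtr_pMl.
have q11 : (q1 < 1)%R.
  have fac : ((1 - b) `^ (1 - s) * (L ^+ 2 - b * kappa ^+ 2) `^ s =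
      q1 * ((1 + c) `^ (1 - s) * (L + c * kappa) `^ s))%R.
    have -> : (1 - b = (1 - c) * (1 + c))%R by rewrite -cb; ring.
    have -> : (L ^+ 2 - b * kappa ^+ 2 = (L - c * kappa) * (L + c * kappa))%R.
      by rewrite -cb; ring.
    rewrite !powRM ?subr_ge0 ?(ltW c1) ?addr_ge0 ?mulr_ge0 ?(ltW c0) ?(ltW k0) ?(ltW L0) ?(ltW Lck)//.
      by rewrite /q1; ring.
    by rewrite -subr_ge0 ltW.
  have big : (1 < (1 + c) `^ (1 - s) * (L + c * kappa) `^ s)%R.
    have h1 : (1 <= (1 + c) `^ (1 - s))%R.
      rewrite -[leLHS](powRr0 (1 + c)) ler_powR ?subr_ge0// lerDl ltW//.
    have h2 : (1 < (L + c * kappa) `^ s)%R.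
      have Lck1 : (1 < L + c * kappa)%R.
        by rewrite (lt_le_trans kappa1)// (le_trans kL)// lerDl mulr_ge0// ltW.
      have := gt0_ltr_powR s0 _ _ Lck1; rewrite powR1.
      by apply; rewrite nnegrE// ltW// (lt_trans _ Lck1).
    by rewrite (lt_le_trans h2)// ler_peMl// powR_ge0.
  have q10 : (0 < q1)%R by rewrite mulr_gt0// powR_gt0// subr_gt0.
  have : (q1 * ((1 + c) `^ (1 - s) * (L + c * kappa) `^ s) <= 1)%R.
    rewrite -fac; apply: le_trans q2; rewrite ler_wpM2l ?powR_ge0//.
    apply: ge0_ler_powR; rewrite ?nnegrE ?(ltW s0)//.
    - have -> : (L ^+ 2 - b * kappa ^+ 2 = (L - c * kappa) * (L + c * kappa))%R.
        by rewrite -cb; ring.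
      by rewrite mulr_ge0 ?(ltW Lck)// addr_ge0 ?mulr_ge0 ?(ltW c0) ?(ltW k0) ?(ltW L0).
    - rewrite subr_ge0 (le_trans _ k2M)// ler_piMl ?sqr_ge0// ltW//.
    - by rewrite lerB.
  by apply: lt_le_trans; rewrite ltr_pMr.
have minor f y : nnmeas f -> A y -> c%:E * \int[nu]_z f z <= kmean P f y.
  move=> nf Ay; apply: le_trans (minor_kmean delta0 hminor nf Ay).
  by rewrite lee_wpmul2r ?lee_fin//; exact: (il_ge0 il_nu).
have VA y : A y -> V y = 1 by exact: hitting_momentA.
have drift_out y : ~ A y -> kappa%:E * kmean P V y <= V y.
  by move=> nAy; rewrite exit_moment_kmean// /V hitting_momentAc.
have drift_in y : A y -> kappa%:E * kmean P V y <= L%:E.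
  by move=> Ay; rewrite exit_moment_kmean// mL.
have vout := jensen_out il_P kmean1 nV V1 k0 drift_out s01.
have vin := jensen_in il_P kmean1 il_nu nu1 c01 minor nV V1 k0 drift_in kL s01 A0.
have Nv := mean_poweR_lty il_P kmean1 il_nu c01 minor nV V1 k0 drift_in s01 A0.
rewrite ks in vout vin.
pose v y := V y `^ s.
have nv : nnmeas v by exact: nnmeas_poweR.
have v1 y : 1 <= v y by exact: poweR_ge1.
have G0 : (0 < Gamma)%R by rewrite (lt_trans _ Gamma1).
pose beta := (c * C0)%R.
have beta0 : (0 <= beta)%R by rewrite mulr_ge0 ?(ltW c0) ?(ltW C00).
(* The 2 covers time 0; the other term solves [C q1 + Gamma beta <= C], which uses [q1 < 1]. *)
pose C := (2 + Gamma * beta / (1 - q1))%R.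
have q1' : (0 < 1 - q1)%R by rewrite subr_gt0.
have C2 : (2 <= C)%R by rewrite lerDl divr_ge0 ?(ltW q1')// mulr_ge0// ltW.
have C_ge0 : (0 <= C)%R by apply: le_trans C2.
have CC : (C * q1 + Gamma * beta <= C)%R.
  have : (Gamma * beta <= C * (1 - q1))%R.
    by rewrite -ler_pdivrMr// lerDr.
  lra.
move=> Vx; exists (C * fine (v x))%R => f n bf f1.
have vx : v x = (fine (v x))%:E by rewrite fineK// ge0_fin_numE ?poweR_lty// nnmeas_ge0.
pose D n y := (iter n T f y - Epi f)%R.
have bD m : bmeas (D m).
  by apply: bmeasB; [exact: (bmeas_iter (bmeas_rmean P))|exact: bmeas_cst].
have bDn m : bmeas (fun y => `|D m y|)%R by exact: bmeas_norm.
have DS m y : D m.+1 y = T (D m) y.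
  rewrite /D /T [RHS](mean_sub (mean_rmean P y)).
  - by rewrite (mean_cst (mean_rmean P y)).
  - exact: (bmeas_iter (bmeas_rmean P)).
  - exact: bmeas_cst.
have nCv : nnmeas (fun y => C%:E * v y) by exact: nnmeasZ.
have NCv : \int[nu]_y (C%:E * v y) = C%:E * \int[nu]_y v y by exact: (il_scale il_nu).
have TCv y : kmean P (fun y => C%:E * v y) y = C%:E * kmean P v y.
  exact: (il_scale (il_P y)).
have absT g y : bmeas g -> (`|T g y| <= T (fun z => `|g z|) y)%R.
  move=> bg; rewrite ler_norml; apply/andP; split.
    rewrite -(mean_opp (mean_rmean P y)); last exact: bmeas_norm.
    apply: (mean_le (mean_rmean P y)) => //; first by apply: bmeasN; exact: bmeas_norm.
    by move=> z; rewrite lerNl -normrN ler_norm.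
  apply: (mean_le (mean_rmean P y)) => //; first exact: bmeas_norm.
  by move=> z; exact: ler_norm.
have minorR g y : bmeas g -> (forall z, 0 <= g z)%R -> A y -> (c * Enu g <= T g y)%R.
  move=> bg g0 Ay; rewrite -lee_fin EFinM EnuE// [X in _ <= X]EFin_rmean//.
  by apply: minor => //; exact: nnmeas_EFin.
(* Positivity of [T - c nu] on [|g| - g] and [|g| + g] gives the triangle inequality for the
   residual kernel; restoring [c nu g] costs at most [c e]. *)
have residualT g y e : bmeas g -> A y -> (`|Enu g| <= e)%R ->
    (`|T g y| + c * Enu (fun z => `|g z|) <= T (fun z => `|g z|) y + c * e)%R.
  move=> bg Ay ge; have bg' := bmeas_norm bg.
  have hm : (c * Enu (fun z => `|g z| - g z) <= T (fun z => `|g z| - g z) y)%R.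
    by apply: minorR => // [|z]; [exact: bmeasB|rewrite subr_ge0 ler_norm].
  have hp : (c * Enu (fun z => `|g z| + g z) <= T (fun z => `|g z| + g z) y)%R.
    apply: minorR => // [|z]; first exact: bmeasD.
    by rewrite -lerBlDr sub0r -normrN ler_norm.
  have TB : (T (fun z => `|g z| - g z) y = T (fun z => `|g z|) y - T g y)%R.
    exact: (mean_sub (mean_rmean P y)).
  have TD : (T (fun z => `|g z| + g z) y = T (fun z => `|g z|) y + T g y)%R.
    exact: (mean_add (mean_rmean P y)).
  rewrite (mean_sub mnu)// TB in hm; rewrite (mean_add mnu)// TD in hp.
  have := ler_wpM2l (ltW c0) ge; rewrite -{1}(gtr0_norm c0) -normrM ler_norml.
  move=> /andP[n1 n2]; rewrite -lerBrDr ler_norml; apply/andP; split; lra.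
have nuD m : (`|Enu (D m)| <= C0 * Gamma ^- m)%R.
  rewrite (mean_sub mnu); [|exact: (bmeas_iter (bmeas_rmean P))|exact: bmeas_cst].
  by rewrite (mean_cst mnu); exact: hC0.
have key : (`|D n x|)%:E <= (Gamma ^- n)%:E * (C%:E * v x).
  apply: (drift_comparison il_P il_nu (ltW c0) minor nCv _ G0 beta0
    (u := fun n x => (`|D n x|)%:E)).
  - rewrite NCv; have : \int[nu]_y v y < +oo by [].
    have /= := il_ge0 il_nu nv; case: (\int[nu]_y v y) => // z _ _.
    by rewrite -EFinM ltry.
  - move=> y nAy; rewrite TCv muleCA lee_wpmul2l ?lee_fin//; exact: vout.
  - move=> y Ay; rewrite TCv NCv muleCA.
    apply: (@le_trans _ _ (C%:E * (q1%:E + (Gamma * c)%:E * \int[nu]_y v y) + (Gamma * beta)%:E)).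
      by rewrite leeD2r// lee_wpmul2l ?lee_fin//; exact: vin.
    have N0 : 0 <= (Gamma * c)%:E * \int[nu]_y v y.
      by rewrite mule_ge0 ?(il_ge0 il_nu)// lee_fin mulr_ge0// ltW.
    have q10 : 0 <= q1%:E by rewrite lee_fin mulr_ge0 ?powR_ge0.
    rewrite ge0_muleDr// addeAC [X in _ <= _ + X]muleCA leeD2r//.
    by rewrite /v VA// poweR_EFin powR1 mule1 -EFinM -EFinD lee_fin.
  - by move=> m; apply: nnmeas_EFin => // y.
  - move=> m y nAy; rewrite -[leRHS]EFin_rmean// lee_fin DS; exact: absT.
  - move=> m y Ay; rewrite -[X in _ <= X + _]EFin_rmean//.
    rewrite -EnuE// -EFinM -!EFinD lee_fin DS.
    by rewrite /beta -mulrA; exact: residualT.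
  - move=> y; apply: (@le_trans _ _ (C%:E * 1)); last by rewrite lee_wpmul2l ?lee_fin.
    rewrite mule1 lee_fin (le_trans _ C2)// (le_trans (ler_normB _ _))//.
    have -> : (2 = 1 + 1 :> R)%R by [].
    by rewrite lerD//=; exact: (mean_norm_le mpi).
by move: key; rewrite vx -!EFinM lee_fin mulrC.
Qed.

End main_case.

(** * Total variation distance through bounded test functions *)

Section total_variation.
Context d (X : measurableType d) (R : realType) dO (Omega : measurableType dO).
Variables (Phi : nat -> {mfun Omega >-> X}) (Pr : X -> probability Omega R).
Variables (P : R.-pker X ~> X) (pi : probability X R).
Hypothesis hPhi : markov_chain Phi Pr P.

Lemma nstep_rmean n x (f : X -> R) : bmeas f ->
  \int[nstep Phi Pr n x]_y (f y)%:E = (iter n (rmean P) f x)%:E.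
Proof.
move=> bf; have p1 : nstep Phi Pr n x setT = 1 by exact: probability_setT.
rewrite -(EFin_Rintegral p1)//; congr _%:E; move: f bf.
have mI := mean_Rintegral p1.
have mJ : mean (fun f => iter n (rmean P) f x).
  elim: n {p1 mI} x => [|n ih] x; first by split.
  apply: (mean_comp (I := rmean P ^~ x) (J := fun f => iter n (rmean P) f)).
  - exact: mean_rmean.
  - by move=> f; apply: bmeas_iter; exact: bmeas_rmean.
  - exact: ih.
apply: additive_eq; [exact: (mean_add mI)|exact: (mean_add mJ)|] => f bf f0.
apply: EFin_inj; rewrite EFin_Rintegral// (nstep_integral hPhi); last exact: nnmeas_EFin.
elim: n {p1 mI mJ} x => // n ih x; rewrite !iterS EFin_rmean; last first.
  by apply: bmeas_iter => //; exact: bmeas_rmean.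
by congr (kmean P _ x); apply/funext => y /=; rewrite -ih.
Qed.

Lemma tv_dist_le n x (K : R) :
  (forall f : X -> R, bmeas f -> (forall y, `|f y| <= 1)%R ->
    (`|iter n (rmean P) f x - \int[pi]_y f y| <= K)%R) ->
  tv_dist (nstep Phi Pr n x) pi <= K%:E.
Proof.
move=> hK; apply: ge_ereal_sup => _ [f [mf f1] <-].
have bf : bmeas f by split=> //; exists 1%R.
have pi1 : pi setT = 1 by exact: probability_setT.
rewrite nstep_rmean// -(EFin_Rintegral pi1)//.
by rewrite -EFinB lee_fin; exact: hK.
Qed.

(** Trivial bound for the cases without decay: [b = 0], and time 0 when [b = 1]. *)
Lemma tv_dist_le2 n x : tv_dist (nstep Phi Pr n x) pi <= 2%:E.
Proof.
apply: tv_dist_le => f bf f1.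
have p1 : nstep Phi Pr n x setT = 1 by exact: probability_setT.
have q1 : pi setT = 1 by exact: probability_setT.
have -> : iter n (rmean P) f x = (\int[nstep Phi Pr n x]_y f y)%R.
  by apply: EFin_inj; rewrite EFin_Rintegral// nstep_rmean.
rewrite (le_trans (ler_normB _ _))// (_ : 2 = 1 + 1 :> R)%R//.
rewrite lerD//; first exact: (mean_norm_le (mean_Rintegral p1)).
exact: (mean_norm_le (mean_Rintegral q1)).
Qed.

End total_variation.

(** * The degenerate case where every step from [A] has law [nu] and [nu A = 1] *)

Section regeneration_everywhere.
Context d (X : measurableType d) (R : realType) dO (Omega : measurableType dO).
Variables (Phi : nat -> {mfun Omega >-> X}) (Pr : X -> probability Omega R).
Variables (P : R.-pker X ~> X) (pi nu : probability X R) (A : set X).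
Hypothesis hPhi : markov_chain Phi Pr P.
Hypothesis hirr : irreducible Phi Pr pi.
Hypothesis hrev : reversible P pi.
Hypothesis mA : measurable A.
Hypothesis hA : 0 < pi A.
Hypothesis hminor : forall x B, measurable B -> (1 * \1_A x)%:E * nu B <= P x B.
Hypothesis nuA : nu A = 1.

(** The minorization gives [P y A >= nu A = 1] on [A], so [A] is absorbing. *)
Lemma atom_full : pi (~` A) = 0.
Proof.
have [x Ax] : A !=set0.
  by apply/set0P/eqP => A00; move: hA; rewrite A00 measure0 ltxx.
apply: (absorbing_full hPhi hirr mA Ax) => y Ay.
have P1 : P y setT = 1 by exact: prob_kernel.
have PA : P y A = 1.
  apply/eqP; rewrite eq_le -{1}P1 le_measure ?inE//=.
  by have := hminor y mA; rewrite indicE mem_set// mulr1 mul1e nuA.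
have : P y (A `|` ~` A) = P y A + P y (~` A).
  by rewrite measureU//; [exact: measurableC|rewrite setICr].
rewrite setUv P1 PA; case: (P y (~` A)) => [z| |]// [h].
by congr _%:E; apply: (addrI 1%R); rewrite addr0 -h.
Qed.

Let T := rmean P.

(** One probability dominating another equals it; here the inequality is used for [f] and for
    [- f]. *)
Let rmean_atom x (f : X -> R) : A x -> bmeas f -> T f x = (\int[nu]_y f y)%R.
Proof.
move=> Ax bf; have nu1 : nu setT = 1 by exact: probability_setT.
have mnu := mean_Rintegral nu1; have mT := mean_rmean P x.
have minor (g : X -> R) : bmeas g -> (forall y, 0 <= g y)%R ->
    (\int[nu]_y g y <= T g x)%R.
  move=> bg g0; rewrite -lee_fin EFin_rmean// EFin_Rintegral//.
  rewrite -[leLHS]mul1e; apply: (minor_kmean _ hminor) => //; exact: nnmeas_EFin.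
have le (g : X -> R) : bmeas g -> (\int[nu]_y g y <= T g x)%R.
  move=> bg; have [M M0 gM] := bmeas_shift bg.
  have bM : bmeas (fun _ : X => M) by exact: bmeas_cst.
  have := minor _ (bmeasD bg bM) gM.
  have -> : (\int[nu]_y (g y + M) = \int[nu]_y g y + M)%R.
    by rewrite (mean_add mnu)// (mean_cst mnu).
  have -> : (T (fun y => g y + M) x = T g x + M)%R.
    by rewrite [LHS](mean_add mT)// (mean_cst mT).
  by rewrite lerD2r.
apply/eqP; rewrite eq_le le// andbT -lerN2.
have := le _ (bmeasN bf).
have -> : (\int[nu]_y (- f y) = - \int[nu]_y f y)%R by exact: (mean_opp mnu).
by have -> : (T (fun y => - f y) x = - T f x)%R by exact: (mean_opp mT).
Qed.

(** On [A], of full measure, [T^(n + 1) f] is a constant, and its mean under [pi] is that of [f] by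
    invariance. *)
Lemma atom_exact x (f : X -> R) n : A x -> bmeas f ->
  iter n.+1 T f x = (\int[pi]_y f y)%R.
Proof.
move=> Ax bf; have pi1 : pi setT = 1 by exact: probability_setT.
have mpi := mean_Rintegral pi1.
have bn : bmeas (iter n T f) by apply: bmeas_iter => //; exact: bmeas_rmean.
rewrite iterS rmean_atom//; set m := (\int[nu]_y _)%R.
have revT := reversible_rmean hrev.
rewrite -(mean_iter (bmeas_rmean P) (mean_rmean P) revT n.+1 bf).
rewrite -[LHS](mean_cst mpi) /Rintegral; congr fine.
have bc : bmeas (fun _ : X => m) by exact: bmeas_cst.
have bS : bmeas (T (iter n T f)) by exact: bmeas_rmean.
apply: ae_eq_integral => //.
- by apply/measurable_EFinP; case: bS.
- exists (~` A); split; [exact: measurableC|exact: atom_full|].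
  move=> y /=; apply: contra_notP => /contrapT Ay _.
  by congr _%:E; apply/esym; exact: rmean_atom.
Qed.

End regeneration_everywhere.

(** * Assembly of the cases [b = 1], [b = 0] and [0 < b < 1] *)

Theorem proposition4p2 (R : realType) (d : measure_display)
  (X : measurableType d) (hX : countably_generated X)
  (dO : measure_display) (Omega : measurableType dO)
  (Phi : nat -> {mfun Omega >-> X}) (Pr : X -> probability Omega R)
  (P : R.-pker X ~> X) (hPhi : markov_chain Phi Pr P)
  (pi : probability X R) (hpi : invariant_probability P pi)
  (hpi_unique : forall mu : probability X R, invariant_probability P mu ->
     forall B, measurable B -> mu B = pi B)
  (hirr : irreducible Phi Pr pi)
  (hac : forall (n : nat) (x : X), (1 <= n)%N -> nstep Phi Pr n x `<< pi)
  (hrev : reversible P pi)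
  (A : set X) (mA : measurable A) (hA : 0 < pi A)
  (kappa : R) (hkappa : (1 < kappa)%R)
  (delta : R) (hdelta : (0 < delta)%R) (nu : probability X R)
  (hminor : forall x B, measurable B -> (delta * \1_A x)%:E * nu B <= P x B)
  (L : R)
  (hL : ereal_sup [set return_moment Phi Pr kappa A x | x in A] = L%:E)
  (theta : R) (htheta : (theta < 1)%R)
  (heven : ereal_sup
     [set \sum_(1 <= n <oo)
            (kappa ^+ (2 * n))%:E * first_return Phi Pr (2 * n) x A
     | x in A] <= theta%:E) :
  let Gamma := rate_Gamma kappa L theta (delta ^+ 2 * fine (nu A)) in
  {ae pi, forall x, exists C : R, forall n : nat,
     tv_dist (nstep Phi Pr n x) pi <= (C * Gamma ^- n)%:E}.
Proof.
move=> Gamma; set b := (delta ^+ 2 * fine (nu A))%R in Gamma *.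
have [x0 Ax0] : A !=set0.
  by apply/set0P/eqP => A00; move: hA; rewrite A00 measure0 ltxx.
have nuAE : nu A = (fine (nu A))%:E by rewrite fineK// fin_num_measure.
have nuA0 : (0 <= fine (nu A))%R by rewrite fine_ge0.
have nuA1 : (fine (nu A) <= 1)%R by rewrite -lee_fin -nuAE probability_le1.
have d1 : (delta <= 1)%R.
  have := hminor x0 _ measurableT; rewrite indicE mem_set// mulr1.
  by rewrite prob_kernel probability_setT mule1 lee_fin.
have d21 : (delta ^+ 2 <= 1)%R by rewrite exprn_ile1// ltW.
have b0 : (0 <= b)%R by rewrite mulr_ge0// sqr_ge0.
have b1 : (b <= 1)%R by rewrite mulr_ile1// sqr_ge0.
have tv2 := tv_dist_le2 pi hPhi.
(* Both factors of [b] are at most 1, so [b = 1] forces [delta = 1] and [nu A = 1]; convergence is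
   then exact from time 1 on. *)
have [b_eq1|b_neq1] := eqVneq b 1%R.
  have nuA_eq1 : nu A = 1.
    rewrite nuAE; congr _%:E; apply/eqP; rewrite eq_le nuA1 -b_eq1.
    by rewrite /b ler_piMl.
  have delta_eq1 : delta = 1%R.
    have d2 : (delta ^+ 2 = 1)%R by rewrite -b_eq1 /b nuA_eq1 mulr1.
    by apply/eqP; rewrite -(eqrXn2 (n := 2)) ?expr1n ?d2// ltW.
  rewrite delta_eq1 in hminor.
  exists (~` A); split; [exact: measurableC|exact: (atom_full hPhi hirr mA hA hminor nuA_eq1)|].
  move=> x /=; apply: contra_notP => /contrapT Ax; exists 2%R => -[|n].
    by rewrite expr0 invr1 mulr1; exact: tv2.
  apply: (tv_dist_le hPhi) => f bf f1.
  rewrite (atom_exact hPhi hirr hrev mA hA hminor nuA_eq1)// subrr normr0.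
  by rewrite mulr_ge0// invr_ge0 exprn_ge0// /Gamma /rate_Gamma b_eq1 eqxx ltW// (lt_trans _ hkappa).
have [b_eq0|b_neq0] := eqVneq b 0%R.
  apply: aeW => x; exists 2%R => n.
  (* For [b = 0] the second term of the minimum is a power of 1, so [Gamma = 1] and no decay is
     claimed. *)
  rewrite /Gamma /rate_Gamma (negbTE b_neq1) b_eq0 subr0 powR1 min_r ?(ltW hkappa)//.
  by rewrite expr1n invr1 mulr1; exact: tv2.
have b01 : (0 < b < 1)%R by rewrite lt_neqAle eq_sym b_neq0 b0 lt_neqAle b_neq1.
have mL x : A x -> exit_moment P A kappa x <= L%:E.
  move=> Ax; rewrite -(return_momentE hPhi mA hkappa) -hL.
  by apply: ereal_sup_ubound; exists x.
have meven x : A x -> even_moment P A kappa x <= theta%:E.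
  move=> Ax; apply: le_trans heven; apply: ereal_sup_ubound; exists x => //.
  rewrite -nneseries_addn; last first.
    by move=> n; rewrite mule_ge0// lee_fin exprn_ge0// ltW// (lt_trans _ hkappa).
  (* The term of index [j + 1] concerns the return time [2 (j + 1)], the successor of [2 j + 1]. *)
  apply: eq_eseriesr => j _; rewrite addn1; congr (_ * _).
  by rewrite mulnS (first_returnE hPhi mA).
exists [set x | hitting_moment P A kappa x = +oo]; split.
- have nV : nnmeas (hitting_moment P A kappa).
    apply: nnmeasD; first exact: nnmeas_indic.
    apply: nnmeasM; last exact: nnmeas_exit_moment.
    by apply: nnmeas_indic; exact: measurableC.
  rewrite (_ : [set _ | _] = [set: X] `&` hitting_moment P A kappa @^-1` [set +oo]).
    by case: nV => mV _; exact: mV.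
  by rewrite setTI.
- exact: (hitting_moment_ae hPhi hirr mA hA hkappa mL).
- move=> x /=; apply: contra_notP => /eqP; rewrite -ltey => Vx.
  have [C hC] := pointwise_decay hPhi hpi hirr hrev mA hA hkappa hdelta hminor mL meven htheta b01 Vx.
  by exists C => n; apply: (tv_dist_le hPhi) => f bf f1; exact: hC.
Qed.
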